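(* Let $\gamma>0$, $p_0\ge1$, $p_0<p_1,p_2<\infty$, $\frac1p=\frac1{p_1}+\frac1{p_2}$ and $q=p/\gamma$. Let $\mathcal{S}$ be a sparse collection of cubes in a dyadic grid of $\mathbb{R}^n$. Let $w,\sigma_1,\sigma_2$ be weights with $[w,\vec\sigma]_{A_{\vec P/p_0}}<\infty$. If $\gamma\ge p_0$, then $$\big\|\mathcal{A}_{p_0,\gamma,\mathcal{S}}(\cdot\,\sigma_1,\cdot\,\sigma_2)\big\|_{L^{p_1}(\sigma_1)\times L^{p_2}(\sigma_2)\to L^p(w)}\lesssim[w,\vec\sigma]_{A_{\vec P/p_0}}^{1/p}\Big([\vec\sigma]_{W^\infty_{\vec P}}^{1/p}+\sum_{i=1}^2[\vec\sigma^i]_{W^\infty_{\vec P^i}}^{\frac1{\gamma(p_i/\gamma)'}}\Big),$$ where the implicit constant does not depend on the weights, $[\vec\sigma]_{W^\infty_{\vec P}}=\sup_Q\Big(\int_Q\prod_{i=1}^2M(\sigma_i\mathbf{1}_Q)^{\frac p{p_i}}dx\Big)\Big(\int_Q\prod_{i=1}^2\sigma_i^{\frac p{p_i}}dx\Big)^{-1}$, and, for $i=1,2$, $[\vec\sigma^i]_{W^\infty_{\vec P^i}}=1$ if $p\le\gamma$ (so that the corresponding term is $1$), and otherwise $$[\vec\sigma^i]_{W^\infty_{\vec P^i}}=\sup_Q\Big(\int_QM(\mathbf{1}_Qw)^{\frac{(p_i/\gamma)'}{q'}}\prod_{j\ne i}M(\mathbf{1}_Q\sigma_j)^{\frac{(p_i/\gamma)'}{p_j/\gamma}}dx\Big)\Big(\int_Qw^{\frac{(p_i/\gamma)'}{q'}}\prod_{j\ne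 i}\sigma_j^{\frac{(p_i/\gamma)'}{p_j/\gamma}}dx\Big)^{-1}.$$ If $\gamma<p_0$, the same estimate still holds for all $p>\gamma$.
   Context: A weight is a locally integrable function on $\mathbb{R}^n$ with values in $(0,\infty)$ a.e.; $\langle f\rangle_Q=\frac1{|Q|}\int_Qf$; suprema over $Q$ run over all cubes with sides parallel to the axes; $M$ is the Hardy–Littlewood maximal operator; $s'$ is the conjugate exponent of $s$. Sparse: $\mathcal{S}$ (contained in a dyadic grid) is sparse if there is $\delta\in(0,1)$ with $\sum_{S'\in \mathrm{ch}_{\mathcal{S}}(S)}|S'|\le\delta|S|$ for all $S\in\mathcal{S}$, where $\mathrm{ch}_{\mathcal{S}}(S)$ is the set of maximal $S'\in\mathcal{S}$ with $S'\subsetneq S$. Operator: $\mathcal{A}_{p_0,\gamma,\mathcal{S}}(f_1,f_2)(x)=\Big(\sum_{Q\in\mathcal{S}}\big[\langle f_1\rangle_{Q,p_0}\langle f_2\rangle_{Q,p_0}\big]^\gamma\mathbf{1}_Q(x)\Big)^{1/\gamma}$ with $\langle f\rangle_{Q,p_0}=\big(\frac1{|Q|}\int_Q|f|^{p_0}\big)^{1/p_0}$. The norm $\|\mathcal{A}_{p_0,\gamma,\mathcal{S}}(\cdot\,\sigma_1,\cdot\,\sigma_2)\|_{L^{p_1}(\sigma_1)\times L^{p_2}(\sigma_2)\to L^p(w)}$ is the least $C$ such that $\|\mathcal{A}_{p_0,\gamma,\mathcal{S}}(f_1\sigma_1,f_2\sigma_2)\|_{L^p(w)}\le C\|f_1\|_{L^{p_1}(\sigma_1)}\|f_2\|_{L^{p_2}(\sigma_2)}$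 for all $f_1,f_2$. $\vec P/p_0=(p_1/p_0,p_2/p_0)$ and $[w,\vec\sigma]_{A_{\vec P/p_0}}=\sup_Q\langle w\rangle_Q\prod_{i=1}^2\langle\sigma_i\rangle_Q^{\frac{p/p_0}{(p_i/p_0)'}}$.
   Formalization: For p_0>1 the stated bound fails under scaling σ_1→λσ_1; the formal theorem bounds A_{p_0,γ,S}(f_1σ_1^{1/p_0}, f_2σ_2^{1/p_0}), i.e. the p_0-averages are taken with respect to σ_i dx, which agrees with the stated operator when p_0=1. *)

(* Defs.v *)
From HB Require Import structures.
From mathcomp Require Import all_boot all_order all_algebra.
From mathcomp Require Import all_classical all_reals all_analysis.

Set Implicit Arguments.
Unset Strict Implicit.
Unset Printing Implicit Defensive.
Import Order.TTheory GRing.Theory Num.Def Num.Theory.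
Import numFieldNormedType.Exports.

Local Open Scope classical_set_scope.
Local Open Scope ring_scope.
Local Open Scope ereal_scope.

(* The sigma-algebra on tuples is the product one, i.e. the Borel sets. *)
Notation euclid R n := (n.-tuple (measurableTypeR R)).

Section cons_measure.
Context {R : realType} {n : nat}.
Variable m : {sigma_finite_measure set (euclid R n) -> \bar R}.

Definition cons_pair (x : measurableTypeR R * euclid R n) : euclid R n.+1 :=
  [the n.+1.-tuple _ of x.1 :: x.2].

Let measurable_cons_pair : measurable_fun [set: _] cons_pair.
Proof. exact: measurable_cons. Qed.

Definition cons_measure : set (euclid R n.+1) -> \bar R :=
  pushforward (@lebesgue_measure R \x m) cons_pair.

Let cons_measure0 : cons_measure set0 = 0.
Proof. by rewrite /cons_measure /pushforward preimage_set0 measure0. Qed.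

Let cons_measure_ge0 A : 0 <= cons_measure A.
Proof. exact: measure_ge0. Qed.

Let cons_measure_sigma_additive : semi_sigma_additive cons_measure.
Proof.
move=> F mF tF mUF; rewrite /cons_measure /pushforward preimage_bigcup.
have mpre A : measurable A -> measurable (cons_pair @^-1` A).
  by move=> mA; rewrite -[X in measurable X]setTI; exact: measurable_cons_pair.
apply: measure_semi_sigma_additive.
- by move=> k; exact: mpre.
- apply/trivIsetP => /= i j _ _ ij; rewrite -preimage_setI.
  by move/trivIsetP : tF => /(_ _ _ _ _ ij) ->//; rewrite preimage_set0.
- by rewrite -preimage_bigcup; exact: mpre.
Qed.

HB.instance Definition _ := isMeasure.Build _ _ _ cons_measure
  cons_measure0 cons_measure_ge0 cons_measure_sigma_additive.

Let cons_measure_sigma_finite : sigma_finite setT cons_measure.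
Proof.
have /sigma_finiteP[F [TF ndF Foo]] := sigma_finiteT (@lebesgue_measure R).
have /sigma_finiteP[G [TG ndG Goo]] := sigma_finiteT m.
pose uncons (x : euclid R n.+1) : measurableTypeR R * euclid R n :=
  (thead x, [tuple of behead x]).
have consK : cancel cons_pair uncons.
  by move=> [a t]; congr pair; exact/val_inj.
have muncons : measurable_fun setT uncons.
  apply/measurable_fun_pairP; split; first exact: measurable_tnth.
  exact: measurable_behead.
exists (fun k => uncons @^-1` (F k `*` G k)).
  apply/seteqP; split=> // x _.
  have [k _ Fk] : (\bigcup_k F k) (uncons x).1 by rewrite -TF.
  have [l _ Gl] : (\bigcup_k G k) (uncons x).2 by rewrite -TG.
  exists (maxn k l) => //; split.
    by move: Fk; exact/subsetPset/ndF/leq_maxl.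
  by move: Gl; exact/subsetPset/ndG/leq_maxr.
move=> k; have [mF Fk] := Foo k; have [mG Gk] := Goo k; split.
  by rewrite -[X in measurable X]setTI; apply: muncons => //; exact: measurableX.
rewrite /cons_measure /pushforward (_ : _ @^-1` _ = F k `*` G k).
  by rewrite product_measure1E// lte_mul_pinfty// ge0_fin_numE.
by apply/seteqP; split=> x; rewrite /preimage /mkset consK.
Qed.

HB.instance Definition _ := Measure_isSigmaFinite.Build _ _ _ cons_measure
  cons_measure_sigma_finite.

End cons_measure.

Fixpoint volume {R : realType} (n : nat) :
    {sigma_finite_measure set (euclid R n) -> \bar R} :=
  match n with
  | 0%N => dirac ([tuple] : euclid R 0)
  | n'.+1 => cons_measure (volume n')
  end.
Arguments volume {R n}.

Section cubes.
Context {R : realType} {n : nat}.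
Implicit Types (Q : set (euclid R n)) (S D : set (set (euclid R n))).

(* Half-open, so that cubes of equal side can tile the space; the boundary of a
   cube is null, so the averages do not depend on this. *)
Definition cube (a : euclid R n) (l : R) : set (euclid R n) :=
  [set x | forall i, (tnth a i <= tnth x i < tnth a i + l)%R].

Definition has_side (l : R) Q := exists a, Q = cube a l.

Definition is_cube Q := exists2 l : R, (0 < l)%R & has_side l Q.

Definition dyadic_grid D :=
  [/\ forall Q, D Q -> exists k : int, has_side (2 ^ k)%R Q,
      forall Q Q', D Q -> D Q' -> Q `&` Q' = Q \/ Q `&` Q' = Q' \/ Q `&` Q' = set0
    & forall (k : int) x, exists! Q, [/\ D Q, has_side (2 ^ k)%R Q & Q x]].

Definition children S Q : set (set (euclid R n)) :=
  [set Q' | [/\ S Q', Q' `<` Q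
              & forall Q'', S Q'' -> Q'' `<` Q -> Q' `<=` Q'' -> Q'' = Q']].

Definition sparse (delta : R) S :=
  forall Q, S Q -> \esum_(Q' in children S Q) volume Q' <= delta%:E * volume Q.

End cubes.

Section weighted.
Context {R : realType} {n : nat}.
Implicit Types (f w s : euclid R n -> R) (g : euclid R n -> \bar R).
Implicit Types (Q : set (euclid R n)) (S : set (set (euclid R n))).

(* Integrability on cubes is local integrability, as every compact set lies in
   a cube. *)
Definition weight w :=
  [/\ measurable_fun setT w,
      forall Q, is_cube Q -> volume.-integrable Q (EFin \o w)
    & {ae volume, forall x, (0 < w x)%R}].

Definition avg f Q : \bar R := (\int[volume]_(x in Q) (f x)%:E) / volume Q.

Definition pavg (r : R) f Q : \bar R :=
  avg (fun x => `|f x| `^ r)%R Q `^ r^-1.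

Definition maximal f x : \bar R :=
  ereal_sup [set avg (fun y => `|f y|%R) Q | Q in [set Q | is_cube Q /\ Q x]].

Definition sparse_op (p0 gamma : R) S (f1 f2 : euclid R n -> R) x : \bar R :=
  (\esum_(Q in S) ((pavg p0 f1 Q * pavg p0 f2 Q) `^ gamma * (\1_Q x)%:E))
    `^ gamma^-1.

Definition wnorm (p : R) w g : \bar R :=
  (\int[volume]_x (`|g x| `^ p * (w x)%:E)) `^ p^-1.

Definition in_Lp (p : R) w f :=
  measurable_fun setT f /\ wnorm p w (EFin \o f) < +oo.

(* The averages of order p0 are taken with respect to the measure sigma_i dx:
   the factor next to f_i is sigma_i^(1/p0), which is sigma_i when p0 = 1. With
   sigma_i itself the norm would scale like sigma_i^(1 - 1/p_i), and not, as the
   A_P/p0 constant to the power 1/p does, like sigma_i^(1/p0 - 1/p_i). *)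
Definition sparse_op_norm (p0 gamma : R) S (p1 p2 p : R) s1 s2 w : \bar R :=
  ereal_inf [set C%:E | C in [set C : R | (0 <= C)%R /\
    forall f1 f2, in_Lp p1 s1 f1 -> in_Lp p2 s2 f2 ->
      wnorm p w (sparse_op p0 gamma S (fun x => f1 x * s1 x `^ p0^-1)%R
                                      (fun x => f2 x * s2 x `^ p0^-1)%R)
      <= C%:E * wnorm p1 s1 (EFin \o f1) * wnorm p2 s2 (EFin \o f2)]].

Definition conj_exp (r : R) : R := fine (hoelder_conjugate r%:E).

Definition A_const (p0 p1 p2 p : R) w s1 s2 : \bar R :=
  ereal_sup [set avg w Q * avg s1 Q `^ (p / p0 / conj_exp (p1 / p0))
                         * avg s2 Q `^ (p / p0 / conj_exp (p2 / p0))
            | Q in is_cube].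

(* [W_const a1 a2 v1 v2] is the supremum common to all the W^infinity constants:
   over Q, int_Q M(v1 1_Q)^a1 M(v2 1_Q)^a2 over int_Q v1^a1 v2^a2. *)
Definition W_const (a1 a2 : R) (v1 v2 : euclid R n -> R) : \bar R :=
  ereal_sup [set (\int[volume]_(x in Q)
                    (maximal (v1 \_ Q) x `^ a1 * maximal (v2 \_ Q) x `^ a2))
                 / (\int[volume]_(x in Q) (v1 x `^ a1 * v2 x `^ a2)%:E)
            | Q in is_cube].

Definition W_infty (p1 p2 p : R) s1 s2 : \bar R :=
  W_const (p / p1) (p / p2) s1 s2.

(* The i-th partial constant; [ri] goes with the removed weight, [rj] and [sj]
   with the other one. *)
Definition W_infty_partial (gamma ri rj p : R) w sj : \bar R :=
  if (p <= gamma)%R then 1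
  else W_const (conj_exp (ri / gamma) / conj_exp (p / gamma))
               (conj_exp (ri / gamma) / (rj / gamma)) w sj.

End weighted.

(* Main.v *)
(* By monotone convergence it is enough to treat the finite subfamilies of [S],
   and the weights may be modified on null sets so as to be positive everywhere.
   Finitely many dyadic cubes [Q_i] form a forest under inclusion, and the cores
   [E_i], [Q_i] minus the smaller cubes of the family, partition the union.  All
   integrals become sums over the forest, and sparseness means that
   [(1 - delta) |Q_i| <= |E_i|].

   Write [eta = gamma / p].  If [eta >= 1], the power [eta^-1] is subadditive, so
   that the A_P quantity of each cube can be pulled out; there remains a Carleson
   embedding, whose constant is W^infinity, and Doob's maximal inequality.

   If [eta < 1], let [G] be the sum defining the operator to the power [gamma] and
   [Z] the integral of [G^(1/eta) w].  Then [Z = sum_i c_i g1_i g2_i g3_i], where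
   [g1], [g2] are powers of weighted averages of [f_1], [f_2] and [g3] is the
   [w]-average of [G^(1/eta - 1)].  The cubes are split into shells on which the
   A_P quantity is about [2^-n A].  On a shell [c_i] is comparable to a product of
   powers of the measures of [Q_i], with total exponent 1 and a small positive
   power of [|Q_i|], so that by sparseness the sum of [c_i] over the cubes of the
   shell inside [Q_j] is at most a multiple of [c_j].  The product of the running
   maxima of [g1], [g2], [g3] along the shell is then a sum of increments; each
   increment falls on one factor, and the other two factors are controlled by the
   W^infinity constant of the corresponding pair of weights, whence the three
   terms of the estimate.  The bounds carry the factor [(2^-n A)^eta] and can be
   summed over the shells; Doob's inequality replaces the maxima by [L^p] norms,
   and the power [Z^(1 - eta)] coming from [g3] is absorbed. *)
Require Import Defs.
From mathcomp Require Import all_boot all_order all_algebra finmap.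
From mathcomp Require Import all_classical all_reals all_analysis.
From mathcomp Require Import zify measurable_realfun ring lra.

Set Implicit Arguments.
Unset Strict Implicit.
Unset Printing Implicit Defensive.
Import Order.TTheory GRing.Theory Num.Def Num.Theory.
Import numFieldNormedType.Exports.

Local Open Scope ring_scope.

Section real_inequalities.
Context {R : realType}.
Implicit Types (a b c d s t x y : R).

Lemma powR_le a b x : 0 <= x -> 0 <= a -> a <= b -> a `^ x <= b `^ x.
Proof.
by move=> x0 a0 ab; apply: ge0_ler_powR; rewrite ?nnegrE// (le_trans a0).
Qed.

Lemma powRDx a x y : 0 < a -> a `^ (x + y) = a `^ x * a `^ y.
Proof. by move=> a0; apply: powRD; rewrite (gt_eqF a0) implybT. Qed.

Lemma powR_superadditive a b c d s t : 0 < s -> 0 < t -> s + t = 1 ->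
  0 <= a -> 0 <= b -> 0 <= c -> 0 <= d ->
  a `^ s * b `^ t + c `^ s * d `^ t <= (a + c) `^ s * (b + d) `^ t.
Proof.
move=> s0 t0 st a0 b0 c0 d0.
have := @hoelder2 R (a `^ s) (c `^ s) (b `^ t) (d `^ t) s^-1 t^-1.
rewrite -!powRrM !divff ?gt_eqF// !powRr1// !invrK; apply => //;
  by rewrite ?powR_ge0 ?invr_gt0.
Qed.

Lemma hoelder_sum (I : finType) (P : pred I) (f g : I -> R) s t :
  0 < s -> 0 < t -> s + t = 1 -> (forall i, 0 <= f i) -> (forall i, 0 <= g i) ->
  \sum_(i | P i) f i `^ s * g i `^ t <=
  (\sum_(i | P i) f i) `^ s * (\sum_(i | P i) g i) `^ t.
Proof.
move=> s0 t0 st f0 g0.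
suff [//] : [/\ 0 <= \sum_(i | P i) f i, 0 <= \sum_(i | P i) g i &
  \sum_(i | P i) f i `^ s * g i `^ t <=
  (\sum_(i | P i) f i) `^ s * (\sum_(i | P i) g i) `^ t].
elim/big_ind3 : _ => [|x1 x2 x3 y1 y2 y3 [a1 a2 a3] [b1 b2 b3]|//].
  by rewrite powR0 ?mul0r ?gt_eqF.
split; [exact: addr_ge0..|].
by apply: le_trans (lerD a3 b3) _; exact: powR_superadditive.
Qed.

Lemma powR_sum_ge (I : finType) (P : pred I) (f : I -> R) s :
  1 <= s -> (forall i, 0 <= f i) ->
  \sum_(i | P i) f i `^ s <= (\sum_(i | P i) f i) `^ s.
Proof.
move=> s1 f0.
suff [//] : 0 <= \sum_(i | P i) f i /\
  \sum_(i | P i) f i `^ s <= (\sum_(i | P i) f i) `^ s.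
elim/big_ind2 : _ => [|x1 x2 y1 y2 [a1 a2] [b1 b2]|//].
  by rewrite powR0 ?gt_eqF// (lt_le_trans ltr01).
split; first exact: addr_ge0.
apply: le_trans (lerD a2 b2) _.
have s0 : 0 < s by rewrite (lt_le_trans ltr01).
rewrite -(mulr_powRB1 (addr_ge0 a1 b1) s0) mulrDl -(mulr_powRB1 a1 s0).
rewrite -(mulr_powRB1 b1 s0).
by rewrite lerD// ler_wpM2l// powR_le ?subr_ge0// ?lerDl ?lerDr.
Qed.

Lemma powR_sum_le (I : finType) (P : pred I) (f : I -> R) s :
  0 < s -> s <= 1 -> (forall i, 0 <= f i) ->
  (\sum_(i | P i) f i) `^ s <= \sum_(i | P i) f i `^ s.
Proof.
move=> s0 s1 f0.
have f0s : 0 <= \sum_(i | P i) f i `^ s by apply: sumr_ge0 => i _; exact: powR_ge0.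
have H : \sum_(i | P i) f i <= (\sum_(i | P i) f i `^ s) `^ s^-1.
  apply: le_trans (powR_sum_ge _ _ _); last by move=> i; exact: powR_ge0.
    apply: ler_sum => i _; by rewrite -powRrM divff ?gt_eqF// powRr1.
  by rewrite invf_ge1.
have := powR_le (ltW s0) _ H.
by rewrite -powRrM mulVf ?gt_eqF// powRr1//; apply; exact: sumr_ge0.
Qed.

End real_inequalities.

(** * Forests *)

(* [le i j] stands for the inclusion of [Q_i] in [Q_j]. *)
Definition forest (I : finType) (le : rel I) :=
  [/\ reflexive le, antisymmetric le, transitive le
    & forall i j k, le i j -> le i k -> le j k || le k j].

Section forest.
Context {R : realType} {I : finType} (le : rel I) (leF : forest le).
Implicit Types (F G a b : I -> R) (i j k : I).

Definition parent i : option I :=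
  [pick p | [&& le i p, p != i & [forall q, le i q && (q != i) ==> le p q]]].

Definition above (d : R) F i := oapp F d (parent i).

Definition incr F i := F i - above 0 F i.

Definition antitone F := forall i j, le i j -> F j <= F i.

Definition star F i : R := \big[Num.max/0]_(j | le i j) F j.

Lemma parentP i :
  match parent i with
  | Some p => [/\ le i p, p != i & forall j, le i j = (j == i) || le p j]
  | None => forall j, le i j = (j == i)
  end.
Proof.
have [lexx leA leT leC] := leF; rewrite /parent; case: pickP => [p|noP].
  move=> /and3P[ip pi /forallP pq]; split=> // j.
  have [->|ji] := eqVneq j i; first by rewrite lexx.
  apply/idP/idP => [ij|/=]; first by have := pq j; rewrite ij ji.
  exact: leT ip.
move=> j; apply/idP/eqP => [ij|->//]; apply/eqP/negP => /negP ji.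
pose P q := le i q && (q != i).
have Pj : P j by rewrite /P ij ji.
case: (arg_minnP (fun q => #|[pred k | le k q]|) Pj) => q /andP[iq qi] qmin.
have := noP q; rewrite iq qi /= => /negP; apply; apply/forallP => k.
apply/implyP => /andP[ik ki]; have /orP[//|kq] := leC _ _ _ iq ik.
have [->|nkq] := eqVneq k q; first exact: lexx.
have := qmin k; rewrite /P ik ki => /(_ isT); rewrite leqNgt => /negP[].
apply: proper_card; apply/properP; split.
  by apply/fintype.subsetP => l; rewrite !inE => /leT; exact.
exists q; rewrite !inE ?lexx//; apply/negP => qk.
by move/eqP: nkq; apply; apply: leA; rewrite kq.
Qed.

Lemma sum_up i F :
  \sum_(j | le i j) F j = F i + above 0 (fun p => \sum_(j | le p j) F j) i.
Proof.
have [lexx leA leT leC] := leF; rewrite /above; have := parentP i.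
rewrite (bigD1 i)//=; case: (parent i) => [p [ip pi ij]|ij] /=; congr (_ + _).
  apply: eq_bigl => j; rewrite ij; have [->|//] := eqVneq j i; last first.
    by rewrite /= andbT.
  rewrite /=; apply/esym/negP => pi'; move/eqP: pi; apply; apply: leA.
  by rewrite pi'.
by rewrite big1// => j; rewrite ij => /andP[/eqP->]; rewrite eqxx.
Qed.

Lemma up_ind (P : I -> Prop) :
  (forall i, (forall j, le i j -> j != i -> P j) -> P i) -> forall i, P i.
Proof.
have [lexx leA leT leC] := leF => H i.
have [n] := ubnP #|[pred k | le i k]|; elim: n i => // n IH i in_.
apply: H => j ij ji; apply: IH; rewrite -ltnS; apply: leq_trans in_.
rewrite ltnS; apply: proper_card; apply/properP; split.
  by apply/fintype.subsetP => l; rewrite !inE => /(leT _ _ _ ij).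
exists i; rewrite !inE ?lexx//; apply/negP => ij'.
by move/eqP: ji; apply; apply: leA; rewrite ij ij'.
Qed.

Lemma sum_incr F i : \sum_(j | le i j) incr F j = F i.
Proof.
elim/up_ind: i => i IH; rewrite sum_up /incr /above; have := parentP i.
case: (parent i) => [p [ip pi _]|_] /=; last by rewrite subr0 addr0.
by rewrite IH// subrK.
Qed.

Lemma incr_ge0 F i : (forall i, 0 <= F i) -> antitone F -> 0 <= incr F i.
Proof.
move=> F0 Fm; rewrite /incr /above; have := parentP i.
by case: (parent i) => [p [ip pi _]|_] /=; rewrite subr_ge0// Fm.
Qed.

Lemma above_ge0 F i : (forall i, 0 <= F i) -> 0 <= above 0 F i.
Proof. by rewrite /above; case: parent => //=. Qed.

Lemma above_le F i : (forall i, 0 <= F i) -> antitone F -> above 0 F i <= F i.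
Proof. by move=> F0 Fm; rewrite -subr_ge0 incr_ge0. Qed.

Lemma sum_incr_mul a F :
  \sum_i a i * F i = \sum_j incr F j * \sum_(i | le i j) a i.
Proof.
under eq_bigr do rewrite -(sum_incr F) mulr_sumr.
rewrite (exchange_big_dep xpredT)//=; apply: eq_bigr => j _.
by rewrite mulr_sumr; apply: eq_bigr => i _; rewrite mulrC.
Qed.

Lemma carleson a b F (C : R) : (forall i, 0 <= F i) -> antitone F ->
  (forall j, \sum_(i | le i j) a i <= C * \sum_(i | le i j) b i) ->
  \sum_i a i * F i <= C * \sum_i b i * F i.
Proof.
move=> F0 Fm ab; rewrite (sum_incr_mul a F) (sum_incr_mul b F) mulr_sumr.
apply: ler_sum => j _.
by rewrite mulrCA ler_wpM2l// incr_ge0.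
Qed.

Lemma star_ge0 F i : 0 <= star F i.
Proof. exact: bigmax_ge_id. Qed.

Lemma star_ge F i : F i <= star F i.
Proof. by have [lexx _ _ _] := leF; apply: le_bigmax_cond. Qed.

Lemma antitone_star F : antitone (star F).
Proof.
have [_ _ leT _] := leF; move=> i j ij; apply: bigmax_le => [|k jk].
  exact: star_ge0.
by apply: le_bigmax_cond; exact: leT jk.
Qed.

Lemma starE F i : (forall i, 0 <= F i) ->
  star F i = Num.max (F i) (above 0 (star F) i).
Proof.
move=> F0; rewrite /above; have := parentP i.
case: (parent i) => [p [ip pi ij]|ij] /=; apply/le_anti/andP; split.
- apply: bigmax_le => [|j]; first by rewrite le_max F0.
  rewrite ij => /predU1P[->|pj]; rewrite le_max ?lexx//.
  by apply/orP; right; apply: le_bigmax_cond.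
- by rewrite ge_max star_ge// antitone_star.
- apply: bigmax_le => [|j]; first by rewrite le_max F0.
  by rewrite ij => /eqP->; rewrite le_max lexx.
- by rewrite ge_max star_ge// star_ge0.
Qed.

Lemma incr_star_neq0 F i : (forall i, 0 <= F i) ->
  incr (star F) i != 0 -> star F i = F i.
Proof.
move=> F0; rewrite /incr starE//; case: (leP (F i)) => //.
by rewrite subrr eqxx.
Qed.

Lemma star_powR F s i : 0 < s -> (forall i, 0 <= F i) ->
  star (fun i => F i `^ s) i = star F i `^ s.
Proof.
move=> s0 F0; elim/up_ind: i => i IH.
rewrite !starE//; last by move=> j; exact: powR_ge0.
have -> : above 0 (star (fun i => F i `^ s)) i = above 0 (star F) i `^ s.
  rewrite /above; have := parentP i.
  by case: (parent i) => [p [ip pi ij]|ij] /=; rewrite ?IH// powR0 ?gt_eqF.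
have A0 := @above_ge0 (star F) i (star_ge0 F).
by case: (leP (F i) (above 0 (star F) i)) => [|/ltW] h;
  [apply/max_idPr|apply/max_idPl]; rewrite powR_le// ltW.
Qed.

End forest.

Section hoelder_four.
Context {R : realType}.
Implicit Types (a b c d s t x y : R).

Lemma powR_absorb x c s t : 0 < s -> s + t = 1 -> 0 <= x -> 0 <= c ->
  x <= c * x `^ t -> x <= c `^ s^-1.
Proof.
move=> s0 st x0 c0 xc; have [->|xN0] := eqVneq x 0; first exact: powR_ge0.
have xp : 0 < x by rewrite lt_def xN0.
have si : 0 <= s^-1 by rewrite invr_ge0 ltW.
have xsc : x `^ s <= c.
  by rewrite -(ler_pM2r (powR_gt0 t xp)) -powRDx// st powRr1.
by have := powR_le si (powR_ge0 _ _) xsc;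
  rewrite -powRrM divff ?gt_eqF// powRr1.
Qed.

Lemma hoelder_sum4 (I : finType) (P : pred I) (f1 f2 f3 f4 : I -> R)
    (k1 k2 k3 k4 : R) :
  0 < k1 -> 0 < k2 -> 0 < k3 -> 0 < k4 -> k1 + k2 + k3 + k4 = 1 ->
  (forall i, 0 <= f1 i) -> (forall i, 0 <= f2 i) ->
  (forall i, 0 <= f3 i) -> (forall i, 0 <= f4 i) ->
  \sum_(i | P i) f1 i `^ k1 * f2 i `^ k2 * f3 i `^ k3 * f4 i `^ k4 <=
  (\sum_(i | P i) f1 i) `^ k1 * (\sum_(i | P i) f2 i) `^ k2
    * (\sum_(i | P i) f3 i) `^ k3 * (\sum_(i | P i) f4 i) `^ k4.
Proof.
move=> k10 k20 k30 k40 k1234 f10 f20 f30 f40.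
have k12 : 0 < k1 + k2 by exact: addr_gt0.
have k34 : 0 < k3 + k4 by exact: addr_gt0.
have split2 (f g : I -> R) (k l : R) : 0 < k -> 0 < l ->
    (forall i, 0 <= f i) -> (forall i, 0 <= g i) ->
    (forall i, f i `^ k * g i `^ l =
       (f i `^ (k / (k + l)) * g i `^ (l / (k + l))) `^ (k + l)) /\
    (\sum_(i | P i) f i `^ (k / (k + l)) * g i `^ (l / (k + l))) `^ (k + l)
      <= (\sum_(i | P i) f i) `^ k * (\sum_(i | P i) g i) `^ l.
  move=> k0 l0 f0 g0; have kl : 0 < k + l by exact: addr_gt0.
  have E (x y : R) : x `^ k * y `^ l =
      (x `^ (k / (k + l)) * y `^ (l / (k + l))) `^ (k + l).
    by rewrite powRM ?powR_ge0// -!powRrM !divfK ?gt_eqF.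
  split=> //; rewrite E; apply: powR_le; [exact: ltW| |].
    by apply: sumr_ge0 => i _; rewrite mulr_ge0 ?powR_ge0.
  apply: hoelder_sum; rewrite ?divr_gt0// -mulrDl divff// gt_eqF//.
have [E12 H12] := split2 f1 f2 k1 k2 k10 k20 f10 f20.
have [E34 H34] := split2 f3 f4 k3 k4 k30 k40 f30 f40.
under eq_bigr do rewrite E12 -mulrA E34.
apply: le_trans (hoelder_sum _ k12 k34 _ _ _) _.
- by rewrite addrA.
- by move=> i; rewrite mulr_ge0 ?powR_ge0.
- by move=> i; rewrite mulr_ge0 ?powR_ge0.
- by rewrite -(mulrA (_ * _)); apply: ler_pM; rewrite ?powR_ge0.
Qed.

End hoelder_four.

Section dyadic.
Context {R : realType} {I : finType} (le : rel I) (leF : forest le).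
Implicit Types (F G a b c e x y : I -> R) (i j k : I).

Definition down a j : R := \sum_(i | le i j) a i.

Lemma down_ge0 a j : (forall i, 0 <= a i) -> 0 <= down a j.
Proof. by move=> a0; exact: sumr_ge0. Qed.

Lemma down_ge a j : (forall i, 0 <= a i) -> a j <= down a j.
Proof.
move=> a0; have [lexx _ _ _] := leF; rewrite /down (bigD1 j)//= lerDl.
exact: sumr_ge0.
Qed.

Lemma down_gt0 a j : (forall i, 0 < a i) -> 0 < down a j.
Proof.
by move=> a0; apply: lt_le_trans (a0 j) _; apply: down_ge => i; exact: ltW.
Qed.

(* Doob's argument: [sum x M^(s-1)] is computed from the increments of
   [M^(s-1)], which live where [M] equals the average, and is compared with
   [sum e M^s] by Young's inequality. *)
Lemma doob e x y s : 1 < s -> (forall i, 0 < e i) -> (forall i, 0 <= x i) ->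
  (forall i, 0 <= y i) -> (forall i, x i <= y i `^ s^-1 * e i `^ (1 - s^-1)) ->
  \sum_i e i * star le (fun j => down x j / down e j) i `^ s
    <= ((1 - s^-1)^-1 `^ s) * \sum_i y i.
Proof.
move=> s1 e0 x0 y0 xy; have s0 : 0 < s by rewrite (lt_trans ltr01).
set F := fun j => down x j / down e j; set M := star le F; set t := 1 - s^-1.
have t0 : 0 < t by rewrite subr_gt0 invf_lt1.
have F0 j : 0 <= F j by rewrite divr_ge0 ?down_ge0// => i; exact: ltW.
have M0 j : 0 <= M j by exact: star_ge0.
have sm0 : 0 < s - 1 by rewrite subr_gt0.
have aboveX (r : R) i : 0 < r -> above le 0 (fun i => M i `^ r) i = above le 0 M i `^ r.
  by move=> r0; rewrite /above; case: parent => //=; rewrite powR0 ?gt_eqF.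
have young (a b : R) : 0 <= a -> 0 <= b -> a `^ (s - 1) * b <= t * a `^ s + b `^ s / s.
  move=> a0 b0; have := @conjugate_powR R (a `^ (s - 1)) b t^-1 s.
  rewrite !invrK -powRrM (_ : (s - 1) / t = s); last first.
    by rewrite /t; field; rewrite gt_eqF//= gt_eqF.
  rewrite (mulrC _ t) invr_gt0; apply => //; first exact: powR_ge0.
  by rewrite /t subrK.
have step j : t * incr le (fun i => M i `^ s) j <=
    incr le (fun i => M i `^ (s - 1)) j * F j.
  have [E|/(incr_star_neq0 leF F0)] := eqVneq (incr le M j) 0.
    move/eqP: E; rewrite /incr !aboveX// subr_eq0 => /eqP<-.
    by rewrite !subrr mulr0 mul0r.
  rewrite -/M => MF; rewrite /incr !aboveX// -MF.
  have b0 := M0 j; have a0 := above_ge0 le j M0; move: (young _ _ a0 b0).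
  have := mulr_powRB1 b0 s0.
  have -> : M j `^ s / s = (1 - t) * M j `^ s by rewrite /t mulrC; ring.
  clearbody t; nra.
have H1 : t * \sum_i e i * M i `^ s <= \sum_i x i * M i `^ (s - 1).
  rewrite (sum_incr_mul leF x) (sum_incr_mul leF e) mulr_sumr; apply: ler_sum => j _.
  have ej : 0 < down e j by exact: down_gt0.
  have -> : \sum_(i | le i j) x i = F j * down e j by rewrite /F divfK ?gt_eqF.
  rewrite !mulrA; apply: ler_wpM2r; first exact: ltW.
  by have := step j; rewrite /F mulrA.
set X := \sum_i e i * M i `^ s in H1 *; set Y := \sum_i y i.
have X0 : 0 <= X by apply: sumr_ge0 => i _; rewrite mulr_ge0 ?powR_ge0 ?ltW.
have H2 : \sum_i x i * M i `^ (s - 1) <= Y `^ s^-1 * X `^ t.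
  apply: le_trans (hoelder_sum _ _ t0 _ y0 _); rewrite ?invr_gt0//; last 2 first.
  - by rewrite /t addrCA subrr addr0.
  - by move=> i; rewrite mulr_ge0 ?powR_ge0 ?ltW.
  apply: ler_sum => i _.
  rewrite (powRM _ (ltW (e0 i)) (powR_ge0 _ _)) -(powRrM (M i)).
  rewrite (_ : s * t = s - 1); last by rewrite /t; field; rewrite gt_eqF.
  rewrite mulrA; apply: ler_wpM2r; [exact: powR_ge0 | exact: xy].
have : X <= t^-1 * Y `^ s^-1 * X `^ t.
  rewrite -mulrA mulrC -ler_pdivrMr ?invr_gt0// invrK mulrC.
  exact: le_trans H2.
have Y0 : 0 <= Y by exact: sumr_ge0.
have ti0 : 0 <= t^-1 by rewrite invr_ge0 ltW.
move=> /powR_absorb - /(_ s^-1); rewrite invrK powRM ?powR_ge0//.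
rewrite -(powRrM Y) mulVf ?gt_eqF// powRr1//; apply; rewrite ?invr_gt0//.
  by rewrite /t addrC subrK.
by rewrite mulr_ge0 ?powR_ge0.
Qed.

End dyadic.

Section kolmogorov.
Context {R : realType} {I : finType} (le : rel I) (leF : forest le).
Implicit Types (F G a b c e x y : I -> R) (i j k : I).

Lemma sum_children_le e j : (forall i, 0 <= e i) ->
  \sum_(k | parent le k == Some j) down le e k <= down le e j - e j.
Proof.
move=> e0; have [lxx leA leT leC] := leF.
have -> : down le e j - e j = \sum_(i | le i j && (i != j)) e i.
  by rewrite /down (bigD1 j)//= addrAC subrr add0r.
rewrite /down (exchange_big_dep (fun i => le i j && (i != j)))/=; last first.
  move=> k i /eqP kj ik; have := parentP leF k; rewrite kj => -[lkj jk _].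
  rewrite (leT _ _ _ ik lkj)/=; apply/eqP => ij; move/eqP: jk; apply.
  by apply: leA; rewrite lkj -ij ik.
apply: ler_sum => i /andP[ij nij].
have [k /andP[kj ik]|none] := pickP [pred k | (parent le k == Some j) && le i k];
  last by rewrite big_pred0.
rewrite (bigD1 k)/= ?kj// big_pred0 ?addr0// => l.
apply/negP => /andP[/andP[/eqP lj il] lk].
wlog kl : k l kj ik lj il lk / le k l => [H|].
  case/orP: (leC _ _ _ ik il) => kl; first exact: (H k l).
  by apply: (H l k) => //; [exact/eqP|exact/eqP|rewrite eq_sym].
have := parentP leF k; rewrite (eqP kj) => -[lkj jk kE].
have := parentP leF l; rewrite lj => -[llj jl lE].
move: kl; rewrite kE (negbTE lk)/= => jl'.
by move/eqP: jl; apply; apply: leA; rewrite jl'.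
Qed.

Lemma geometric_down c (r : R) j : r < 1 -> (forall i, 0 <= c i) ->
  (forall i, \sum_(k | parent le k == Some i) c k <= r * c i) ->
  down le c j <= (1 - r)^-1 * c j.
Proof.
move=> r1 c0 cr; have [lxx leA leT leC] := leF.
rewrite mulrC ler_pdivlMr ?subr_gt0// mulrBr mulr1.
have H : \sum_(i | le i j && (i != j)) c i <= down le c j * r.
  rewrite mulrC; apply: (@le_trans _ _
      (\sum_(i | le i j) \sum_(k | parent le k == Some i) c k)); last first.
    by rewrite /down mulr_sumr; apply: ler_sum => i _.
  rewrite (exchange_big_dep xpredT)//= big_mkcond/=; apply: ler_sum => k _.
  case: ifPn => [/andP[kj nkj]|_]; last exact: sumr_ge0.
  have := parentP leF k; case: (parent le k) => [p [kp pk kE]|kE].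
    have pj : le p j by move: kj; rewrite kE eq_sym (negbTE nkj).
    by rewrite (bigD1 p)/= ?pj ?eqxx// lerDl sumr_ge0.
  by move: kj; rewrite kE eq_sym (negbTE nkj).
by rewrite lerBlDr {1}/down (bigD1 j)//= lerD2l.
Qed.

(* The children of a cube carry at most the fraction [d] of its [e4]-mass, so a
   generation loses the factor [d `^ k4]. *)
Lemma kolmogorov c e1 e2 e3 e4 (k1 k2 k3 k4 d : R) j :
  0 < k1 -> 0 < k2 -> 0 < k3 -> 0 < k4 -> k1 + k2 + k3 + k4 = 1 ->
  0 <= d -> d < 1 ->
  (forall i, 0 < e1 i) -> (forall i, 0 < e2 i) -> (forall i, 0 < e3 i) ->
  (forall i, 0 < e4 i) -> (forall i, (1 - d) * down le e4 i <= e4 i) ->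
  (forall i, c i = down le e1 i `^ k1 * down le e2 i `^ k2
                   * down le e3 i `^ k3 * down le e4 i `^ k4) ->
  down le c j <= (1 - d `^ k4)^-1 * c j.
Proof.
move=> k10 k20 k30 k40 kE d0 d1 e10 e20 e30 e40 sp cE.
have dk1 : d `^ k4 < 1.
  have one : 1 `^ k4 = 1 :> R by rewrite powR1.
  by rewrite -[ltRHS]one gt0_ltr_powR ?nnegrE.
have ge0 (f : I -> R) i : (forall i, 0 < f i) -> 0 <= down le f i.
  by move=> f0; apply: down_ge0 => k; exact: ltW.
have S (f : I -> R) i : (forall i, 0 < f i) ->
    \sum_(k | parent le k == Some i) down le f k <= down le f i.
  move=> f0; apply: le_trans (sum_children_le _ _) _ => [k|]; first exact: ltW.
  by rewrite lerBlDr lerDl ltW.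
apply: geometric_down => // [i|i]; first by rewrite cE !mulr_ge0 ?powR_ge0.
rewrite cE; under eq_bigr do rewrite cE.
apply: le_trans (hoelder_sum4 _ k10 k20 k30 k40 kE _ _ _ _) _;
  try by move=> k; exact: ge0.
have P (f : I -> R) (k : R) : 0 < k -> (forall i, 0 < f i) ->
    (\sum_(l | parent le l == Some i) down le f l) `^ k <= down le f i `^ k.
  move=> k0 f0; apply: powR_le; [exact: ltW| |exact: S].
  by apply: sumr_ge0 => l _; exact: ge0.
rewrite [leRHS]mulrCA; apply: ler_pM; rewrite ?mulr_ge0 ?powR_ge0//.
  by apply: ler_pM; rewrite ?mulr_ge0 ?powR_ge0 ?P//;
     apply: ler_pM; rewrite ?powR_ge0 ?P.
rewrite -powRM//; last exact: ge0.
apply: powR_le; first exact: ltW.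
  by apply: sumr_ge0 => k _; exact: ge0.
apply: le_trans (sum_children_le _ _) _ => [k|]; first exact: ltW.
by have := sp i; lra.
Qed.

End kolmogorov.

Lemma powR_pairE {R : realType} (a b k l s : R) : s != 0 ->
  (a `^ (k / s) * b `^ (l / s)) `^ s = a `^ k * b `^ l.
Proof.
by move=> s0; rewrite powRM ?powR_ge0// -(powRrM a) -(powRrM b) !divfK.
Qed.

(** * Carleson embeddings *)

Section embeddings.
Context {R : realType} {I : finType} (le : rel I) (leF : forest le).
Implicit Types (D F G a b c e g v : I -> R) (i j k : I).

Definition pair_carleson e1 e2 (s t W : R) := forall j,
  \sum_(i | le i j) down le e1 i `^ s * down le e2 i `^ t
    <= W * \sum_(i | le i j) e1 i `^ s * e2 i `^ t.

Lemma pair_carlesonC e1 e2 (s t W : R) :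
  pair_carleson e1 e2 s t W -> pair_carleson e2 e1 t s W.
Proof.
move=> H j; under eq_bigr do rewrite mulrC.
by under [in leRHS]eq_bigr do rewrite mulrC; exact: H.
Qed.

Lemma antitoneM F G : (forall i, 0 <= F i) -> (forall i, 0 <= G i) ->
  antitone le F -> antitone le G -> antitone le (fun i => F i * G i).
Proof. by move=> F0 G0 Fm Gm i j ij; apply: ler_pM => //; [exact: Fm|exact: Gm]. Qed.

Lemma antitone_powR F (s : R) : 0 <= s -> (forall i, 0 <= F i) ->
  antitone le F -> antitone le (fun i => F i `^ s).
Proof. by move=> s0 F0 Fm i j ij; apply: powR_le => //; exact: Fm. Qed.

Lemma pair_embedding e1 e2 G1 G2 (s t W : R) :
  0 < s -> 0 < t -> s + t = 1 -> 0 <= W ->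
  (forall i, 0 <= e1 i) -> (forall i, 0 <= e2 i) ->
  (forall i, 0 <= G1 i) -> (forall i, 0 <= G2 i) ->
  antitone le G1 -> antitone le G2 -> pair_carleson e1 e2 s t W ->
  \sum_i (down le e1 i `^ s * down le e2 i `^ t) * (G1 i `^ s * G2 i `^ t)
    <= W * ((\sum_i e1 i * G1 i) `^ s * (\sum_i e2 i * G2 i) `^ t).
Proof.
move=> s0 t0 st W0 e10 e20 G10 G20 G1m G2m H.
pose F i := G1 i `^ s * G2 i `^ t.
have F0 i : 0 <= F i by rewrite mulr_ge0 ?powR_ge0.
have Fm : antitone le F.
  by apply: antitoneM; do ?[by move=> i; exact: powR_ge0];
     apply: antitone_powR => //; exact: ltW.
apply: le_trans (carleson leF F0 Fm H) _; apply: ler_wpM2l => //.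
under eq_bigr do rewrite /F mulrACA -!powRM//.
by apply: hoelder_sum => // i; exact: mulr_ge0.
Qed.

Lemma embedding_term e1 e2 e3 g1 g2 g3 D (t1 t2 t3 W : R) :
  0 < t1 -> 0 < t2 -> 0 < t3 -> t1 + t2 + t3 = 1 -> 0 <= W ->
  (forall i, 0 <= e1 i) -> (forall i, 0 <= e2 i) -> (forall i, 0 <= e3 i) ->
  (forall i, 0 <= g1 i) -> (forall i, 0 <= g2 i) -> (forall i, 0 <= D i) ->
  antitone le g1 -> antitone le g2 ->
  (forall i, \sum_(j | le i j) D j <= g3 i) ->
  pair_carleson e1 e2 (t1 / (t1 + t2)) (t2 / (t1 + t2)) W ->
  \sum_j D j * (g1 j * g2 j)
      * (down le e1 j `^ t1 * down le e2 j `^ t2 * down le e3 j `^ t3)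
  <= W `^ (t1 + t2) * ((\sum_i e1 i * g1 i `^ t1^-1) `^ t1
     * (\sum_i e2 i * g2 i `^ t2^-1) `^ t2
     * (\sum_i e3 i * g3 i `^ t3^-1) `^ t3).
Proof.
move=> t10 t20 t30 tE W0 e10 e20 e30 g10 g20 D0 g1m g2m Dg H.
have s0 : 0 < t1 + t2 by exact: addr_gt0.
set s := t1 + t2 in tE s0 H *.
pose f3 j := D j `^ t3^-1 * down le e3 j.
pose f12 j := (down le e1 j `^ (t1 / s) * down le e2 j `^ (t2 / s))
  * ((g1 j `^ t1^-1) `^ (t1 / s) * (g2 j `^ t2^-1) `^ (t2 / s)).
have v0 e j : (forall i, 0 <= e i) -> 0 <= down le e j by exact: down_ge0.
have f30 j : 0 <= f3 j by rewrite mulr_ge0 ?powR_ge0 ?v0.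
have f120 j : 0 <= f12 j by rewrite !mulr_ge0 ?powR_ge0.
have E j : D j * (g1 j * g2 j)
      * (down le e1 j `^ t1 * down le e2 j `^ t2 * down le e3 j `^ t3) =
    f12 j `^ s * f3 j `^ t3.
  rewrite /f12 /f3 [X in _ = X `^ s * _]mulrC.
  rewrite (powRM s (mulr_ge0 (powR_ge0 _ _) (powR_ge0 _ _))
                   (mulr_ge0 (powR_ge0 _ _) (powR_ge0 _ _))).
  rewrite (powRM t3 (powR_ge0 _ _) (v0 _ _ e30)) !powR_pairE ?gt_eqF//.
  rewrite -(powRrM (g1 j)) -(powRrM (g2 j)) -(powRrM (D j)).
  rewrite !mulVf ?gt_eqF// !powRr1//.
  by rewrite [D j * _]mulrC mulrACA.
under eq_bigr do rewrite E.
apply: le_trans (hoelder_sum _ s0 t30 tE f120 f30) _.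
rewrite mulrA; apply: ler_pM; rewrite ?powR_ge0//.
  have ts : t1 / s + t2 / s = 1 by rewrite -mulrDl divff ?gt_eqF.
  have ti0 t : 0 < t -> 0 <= t^-1 :> R by move=> t0; rewrite invr_ge0 ltW.
  have {}H := pair_embedding (divr_gt0 t10 s0) (divr_gt0 t20 s0) ts W0 e10 e20
    (fun i => powR_ge0 (g1 i) t1^-1) (fun i => powR_ge0 (g2 i) t2^-1)
    (antitone_powR (ti0 _ t10) g10 g1m) (antitone_powR (ti0 _ t20) g20 g2m) H.
  apply: le_trans (powR_le (ltW s0) _ H) _.
    by apply: sumr_ge0 => i _; exact: f120.
  rewrite powRM ?powR_pairE ?gt_eqF//.
  by rewrite mulr_ge0// powR_ge0.
apply: powR_le; rewrite ?(ltW t30)//; first by apply: sumr_ge0 => i _; exact: f30.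
under [leRHS]eq_bigr do rewrite mulrC.
have -> : \sum_i f3 i = \sum_i \sum_(j | le j i) D i `^ t3^-1 * e3 j.
  by apply: eq_bigr => i _; rewrite /f3 /down mulr_sumr.
rewrite (exchange_big_dep xpredT)//=; apply: ler_sum => i _.
rewrite -mulr_suml; apply: ler_wpM2r => //.
apply: le_trans (powR_sum_ge _ _ D0) _.
  by rewrite invf_ge1// -tE lerDr ltW.
apply: powR_le => //; [by rewrite invr_ge0 ltW|exact: sumr_ge0].
Qed.

End embeddings.

Section trilinear.
Context {R : realType} {I : finType} (le : rel I) (leF : forest le).
Implicit Types (D F G a b c e g v : I -> R) (i j k : I).

(* The increments of the running maximum over [J] vanish outside [J], so the
   bounds on [c] are only needed there; an increment on [g_k] leaves the maxima of the two
   other functions, paired by [embedding_term]. *)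
Lemma trilinear (J : pred I) c e1 e2 e3 g1 g2 g3 (t1 t2 t3 K B W12 W13 W23 : R) :
  0 < t1 -> 0 < t2 -> 0 < t3 -> t1 + t2 + t3 = 1 ->
  0 <= K -> 0 <= B -> 0 <= W12 -> 0 <= W13 -> 0 <= W23 ->
  (forall i, 0 <= c i) ->
  (forall i, 0 <= e1 i) -> (forall i, 0 <= e2 i) -> (forall i, 0 <= e3 i) ->
  (forall i, 0 <= g1 i) -> (forall i, 0 <= g2 i) -> (forall i, 0 <= g3 i) ->
  (forall j, J j -> \sum_(i | le i j && J i) c i <= K * c j) ->
  (forall j, J j ->
     c j <= B * (down le e1 j `^ t1 * down le e2 j `^ t2 * down le e3 j `^ t3)) ->
  pair_carleson le e1 e2 (t1 / (t1 + t2)) (t2 / (t1 + t2)) W12 ->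
  pair_carleson le e1 e3 (t1 / (t1 + t3)) (t3 / (t1 + t3)) W13 ->
  pair_carleson le e2 e3 (t2 / (t2 + t3)) (t3 / (t2 + t3)) W23 ->
  \sum_(i | J i) c i * (g1 i * g2 i * g3 i) <=
    K * B * (W12 `^ (t1 + t2) + W13 `^ (t1 + t3) + W23 `^ (t2 + t3))
    * ((\sum_i e1 i * star le g1 i `^ t1^-1) `^ t1
     * (\sum_i e2 i * star le g2 i `^ t2^-1) `^ t2
     * (\sum_i e3 i * star le g3 i `^ t3^-1) `^ t3).
Proof.
move=> t10 t20 t30 tE K0 B0 W120 W130 W230 c0 e10 e20 e30 g10 g20 g30 cJ cB.
move=> H12 H13 H23.
pose r g i := if J i then g i else 0; pose h g := star le (r g).
have r0 g i : (forall i, 0 <= g i) -> 0 <= r g i.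
  by move=> g0; rewrite /r; case: ifP.
have h0 g i : 0 <= h g i by exact: star_ge0.
have s0 g i : 0 <= star le g i by exact: star_ge0.
have hm g : antitone le (h g) by exact: antitone_star.
have hs g i : (forall i, 0 <= g i) -> h g i <= star le g i.
  move=> g0; apply: bigmax_le => [//|j ij]; rewrite /r; case: ifP => // _.
  exact: le_bigmax_cond.
have d0 g j : (forall i, 0 <= g i) -> 0 <= incr le (h g) j.
  by move=> g0; apply: incr_ge0.
have dJ g j : (forall i, 0 <= g i) -> ~~ J j -> incr le (h g) j = 0.
  move=> g0 nJ; have rg0 i := r0 g i g0.
  apply/eqP/negPn/negP => ne; have := incr_star_neq0 leF rg0 ne.
  rewrite {2}/r (negbTE nJ) => E; move/eqP: ne; apply; apply/le_anti.
  by rewrite d0// andbT /incr -/(h g j) /h E sub0r oppr_le0 above_ge0.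
pose F i := h g1 i * h g2 i * h g3 i.
have incrF j : incr le F j <= incr le (h g1) j * (star le g2 j * star le g3 j)
    + incr le (h g2) j * (star le g1 j * star le g3 j)
    + incr le (h g3) j * (star le g1 j * star le g2 j).
  have -> : incr le F j = incr le (h g1) j * (h g2 j * h g3 j)
      + incr le (h g2) j * (above le 0 (h g1) j * h g3 j)
      + incr le (h g3) j * (above le 0 (h g1) j * above le 0 (h g2) j).
    by rewrite /incr /above /F; case: (parent le j) => [p|] /=; ring.
  have ah g : above le 0 (h g) j <= h g j by apply: above_le.
  have a0 g : 0 <= above le 0 (h g) j by exact: above_ge0.
  have as_ g : (forall i, 0 <= g i) -> above le 0 (h g) j <= star le g j.
    by move=> g0; apply: le_trans (ah g) (hs _ _ g0).
  by do 2?apply: lerD; apply: ler_wpM2l; rewrite ?d0//; apply: ler_pM;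
    rewrite ?hs ?as_.
have incrFJ j : ~~ J j -> incr le F j = 0.
  move=> nJ; move: (dJ g1 j g10 nJ) (dJ g2 j g20 nJ) (dJ g3 j g30 nJ).
  rewrite /incr => /eqP; rewrite subr_eq0 => /eqP E1.
  move/eqP; rewrite subr_eq0 => /eqP E2; move/eqP; rewrite subr_eq0 => /eqP E3.
  rewrite {1}/F E1 E2 E3 /above /F; case: (parent le j) => [p|] /=; ring.
have F0 i : 0 <= F i by rewrite !mulr_ge0.
have Fm : antitone le F.
  by apply: antitoneM => // [i|]; [rewrite mulr_ge0|apply: antitoneM].
pose v j := down le e1 j `^ t1 * down le e2 j `^ t2 * down le e3 j `^ t3.
have v0 j : 0 <= v j by rewrite !mulr_ge0 ?powR_ge0.
have step1 : \sum_(i | J i) c i * (g1 i * g2 i * g3 i) <= K * B *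
    (\sum_j incr le (h g1) j * (star le g2 j * star le g3 j) * v j
    + \sum_j incr le (h g2) j * (star le g1 j * star le g3 j) * v j
    + \sum_j incr le (h g3) j * (star le g1 j * star le g2 j) * v j).
  rewrite -!big_split mulr_sumr.
  apply: (@le_trans _ _ (\sum_i r c i * F i)).
    rewrite big_mkcond; apply: ler_sum => i _; rewrite /r; case: ifPn => [Ji|_].
      have gh g : (forall i, 0 <= g i) -> g i <= h g i.
        by move=> g0; have := star_ge leF (r g) i; rewrite {1}/r Ji.
      by apply: ler_wpM2l => //; apply: ler_pM; rewrite ?mulr_ge0 ?gh//;
         apply: ler_pM; rewrite ?gh.
    by rewrite mul0r.
  rewrite (sum_incr_mul leF); apply: ler_sum => j _ /=.
  have R0 := le_trans (incr_ge0 leF j F0 Fm) (incrF j).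
  rewrite -!mulrDl; have [Jj|nJ] := boolP (J j); last first.
    by rewrite incrFJ// mul0r (mulr_ge0 (mulr_ge0 K0 B0) (mulr_ge0 R0 (v0 j))).
  rewrite [leRHS]mulrCA; apply: ler_pM; rewrite ?incr_ge0 ?sumr_ge0//.
    by move=> i _; exact: r0.
  have -> : \sum_(i | le i j) r c i = \sum_(i | le i j && J i) c i.
    by rewrite [RHS]big_mkcondr.
  by apply: le_trans (cJ j Jj) _; rewrite -mulrA; apply: ler_wpM2l => //; exact: cB.
apply: le_trans step1 _; rewrite -[leRHS]mulrA; apply: ler_wpM2l.
  by rewrite mulr_ge0.
have dsum g i : (forall i, 0 <= g i) -> \sum_(j | le i j) incr le (h g) j <= star le g i.
  by move=> g0; rewrite sum_incr// hs.
have tE2 : t1 + t3 + t2 = 1 by rewrite addrAC.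
have tE1 : t2 + t3 + t1 = 1 by rewrite addrC addrA.
have sm g : antitone le (star le g) by exact: antitone_star.
have T3 := embedding_term leF t10 t20 t30 tE W120 e10 e20 e30 (s0 g1) (s0 g2)
  (d0 g3 ^~ g30) (sm g1) (sm g2) (dsum g3 ^~ g30) H12.
have T2 := embedding_term leF t10 t30 t20 tE2 W130 e10 e30 e20 (s0 g1) (s0 g3)
  (d0 g2 ^~ g20) (sm g1) (sm g3) (dsum g2 ^~ g20) H13.
have T1 := embedding_term leF t20 t30 t10 tE1 W230 e20 e30 e10 (s0 g2) (s0 g3)
  (d0 g1 ^~ g10) (sm g2) (sm g3) (dsum g1 ^~ g10) H23.
have P1 (x y z : R) : x * y * z = y * z * x by ring.
have P2 (x y z : R) : x * y * z = x * z * y by ring.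
set N := (X in _ <= _ * X).
have -> : (W12 `^ (t1 + t2) + W13 `^ (t1 + t3) + W23 `^ (t2 + t3)) * N =
  W23 `^ (t2 + t3) * N + W13 `^ (t1 + t3) * N + W12 `^ (t1 + t2) * N by ring.
apply: lerD; first apply: lerD; last exact: T3.
- rewrite /N P1; apply: le_trans T1; apply: ler_sum => j _.
  by rewrite /v (P1 (down le e1 j `^ t1)).
- rewrite /N P2; apply: le_trans T2; apply: ler_sum => j _.
  by rewrite /v (P2 (down le e1 j `^ t1)).
Qed.

End trilinear.

(** * The sparse form on a forest *)

Section sparse_form.
Context {R : realType}.
Implicit Types (a b s t x y z : R).

Lemma exp_shell x : 0 < x -> x <= 1 ->
  exists n, 2^-1 ^+ n.+1 < x /\ x <= 2^-1 ^+ n :> R.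
Proof.
move=> x0 x1.
have ex : exists n, 2^-1 ^+ n.+1 < x.
  pose m := Num.truncn x^-1; exists m.
  have xm : x^-1 < m.+1%:R by rewrite truncnS_gt.
  have m2 : m.+1%:R <= 2 ^+ m.+1 :> R by rewrite -natrX ler_nat ltnW// ltn_expl.
  rewrite exprVn invf_plt ?posrE ?exprn_gt0//; exact: lt_le_trans xm m2.
case: (ex_minnP ex) => n nx nmin; exists n; split=> //.
case: n nx nmin => [|n] nx nmin; first by rewrite expr0.
by rewrite leNgt; apply/negP => /nmin; rewrite ltnn.
Qed.

(* Extracts the power [th] of the A_P quantity.  The exponents of the other factors
   add up to 1; for [th = eta] the power of [v] vanishes, and for [th] slightly
   larger it is positive, as [kolmogorov] requires. *)
Lemma shell_identity (w s1 s2 v a b1 b2 th : R) :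
  0 < w -> 0 < s1 -> 0 < s2 -> 0 < v ->
  v * (w / v) * ((s1 / v) `^ a * (s2 / v) `^ a) =
  (w / v * (s1 / v) `^ b1 * (s2 / v) `^ b2) `^ th
  * (w `^ (1 - th) * s1 `^ (a - th * b1) * s2 `^ (a - th * b2)
     * v `^ (th * (1 + b1 + b2) - 2 * a)).
Proof.
move=> w0 s10 s20 v0.
have ex (r : R) : 0 < r -> exists l, r = expR l by move=> r0; exists (ln r); rewrite lnK.
have [w' ->] := ex _ w0; have [s1' ->] := ex _ s10.
have [s2' ->] := ex _ s20; have [v' ->] := ex _ v0.
by rewrite -!expRN -!expRD -!expRM -!expRD -!expRM -!expRD; congr expR; ring.
Qed.

Lemma geometric_sum_le (r : R) n : 0 <= r -> r < 1 ->
  \sum_(i < n) r ^+ i <= (1 - r)^-1.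
Proof.
move=> r0 r1; rewrite -[leRHS]mul1r ler_pdivlMr ?subr_gt0//.
have -> : (\sum_(i < n) r ^+ i) * (1 - r) = 1 - r ^+ n.
  by rewrite -[RHS]opprB subrX1 -mulNr opprB mulrC.
by rewrite gerBl exprn_ge0.
Qed.

Lemma powR_exprn (x s : R) n : 0 <= x -> (x ^+ n) `^ s = (x `^ s) ^+ n.
Proof.
move=> x0; elim: n => [|n IH]; first by rewrite !expr0 powR1.
by rewrite !exprS powRM ?IH// exprn_ge0.
Qed.

(* [e1], [e2], [ew], [ev] are the masses on the cores of [sigma_1 dx], [sigma_2 dx],
   [w dx] and [dx], and [xk], [yk] those of [|f_k|^p0 sigma_k] and
   [|f_k|^pk sigma_k]; [a = gamma / p0] and [tk = gamma / pk]. *)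
Record sparse_model {I : finType} (le : rel I) (d a t1 t2 A : R)
    (e1 e2 ew ev x1 x2 y1 y2 : I -> R) : Prop := SparseModel {
  model_forest : forest le;
  model_e1 : forall i, 0 < e1 i;
  model_e2 : forall i, 0 < e2 i;
  model_ew : forall i, 0 < ew i;
  model_ev : forall i, 0 < ev i;
  model_x1 : forall i, 0 <= x1 i;
  model_x2 : forall i, 0 <= x2 i;
  model_y1 : forall i, 0 <= y1 i;
  model_y2 : forall i, 0 <= y2 i;
  model_xy1 : forall i, x1 i <= y1 i `^ (t1 / a) * e1 i `^ (1 - t1 / a);
  model_xy2 : forall i, x2 i <= y2 i `^ (t2 / a) * e2 i `^ (1 - t2 / a);
  model_sparse : forall i, (1 - d) * down le ev i <= ev i;
  model_A : forall i, down le ew i / down le ev i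
    * (down le e1 i / down le ev i) `^ ((a - t1) / (t1 + t2))
    * (down le e2 i / down le ev i) `^ ((a - t2) / (t1 + t2)) <= A }.

Definition coef {I : finType} (le : rel I) a (ev x1 x2 : I -> R) i : R :=
  (down le x1 i / down le ev i) `^ a * (down le x2 i / down le ev i) `^ a.

Lemma doob_star {I : finType} (le : rel I) a t (e x y : I -> R) :
  forest le -> 0 < t -> t < a ->
  (forall i, 0 < e i) -> (forall i, 0 <= x i) -> (forall i, 0 <= y i) ->
  (forall i, x i <= y i `^ (t / a) * e i `^ (1 - t / a)) ->
  \sum_i e i * star le (fun j => (down le x j / down le e j) `^ a) i `^ t^-1
    <= ((1 - t / a)^-1 `^ (a / t)) * \sum_i y i.
Proof.
move=> leF t0 ta e0 x0 y0 xy; have a0 : 0 < a by exact: lt_trans ta.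
have := @doob R I le leF e x y (a / t) _ e0 x0 y0.
rewrite invf_div ltr_pdivlMr// mul1r => /(_ ta xy); apply: le_trans.
rewrite le_eqVlt; apply/orP; left; apply/eqP; apply: eq_bigr => i _.
rewrite star_powR// -?powRrM// => j.
by rewrite divr_ge0 ?down_ge0// => k; exact: ltW.
Qed.

Lemma sparse_form_gt a t1 t2 d : 0 < t1 -> t1 < a -> 0 < t2 -> t2 < a ->
  t1 + t2 < 1 -> 0 < d -> d < 1 -> exists2 C : R, 0 < C &
  forall (I : finType) (le : rel I) (A : R) (e1 e2 ew ev x1 x2 y1 y2 : I -> R)
    (W12 W1 W2 : R),
  0 < A -> 0 <= W12 -> 0 <= W1 -> 0 <= W2 ->
  sparse_model le d a t1 t2 A e1 e2 ew ev x1 x2 y1 y2 ->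
  let eta := t1 + t2 in let t3 := 1 - eta in
  pair_carleson le e1 e2 (t1 / eta) (t2 / eta) W12 ->
  pair_carleson le e1 ew (t1 / (t1 + t3)) (t3 / (t1 + t3)) W2 ->
  pair_carleson le e2 ew (t2 / (t2 + t3)) (t3 / (t2 + t3)) W1 ->
  (\sum_i ew i * (\sum_(j | le i j) coef le a ev x1 x2 j) `^ eta^-1) `^ eta <=
  C * (A `^ eta * (W12 `^ eta + W2 `^ (t1 + t3) + W1 `^ (t2 + t3))
       * ((\sum_i y1 i) `^ t1 * (\sum_i y2 i) `^ t2)).
Proof.
have reorder (k b w c y z : R) :
  k * b * w * (c * y * z) = k * c * (b * w * y) * z by ring.
have reorder2 (k l b c y z : R) :
  k * b * (l * c) * (y * z) = k * l * y * (b * c) * z by ring.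
have dbl (x h b : R) : 2^-1 * h * b < x -> b * h <= 2 * x by lra.
move=> t10 t1a t20 t2a eta1 d0 d1.
pose eta := t1 + t2; pose t3 := 1 - eta.
have eta0 : 0 < eta by exact: addr_gt0.
have t30 : 0 < t3 by rewrite subr_gt0.
have a0 : 0 < a by exact: lt_trans t1a.
have t11 : t1 < 1 by rewrite /eta in eta0 eta1 *; lra.
have t21 : t2 < 1 by rewrite /eta in eta0 eta1 *; lra.
have t31 : t3 < 1 by rewrite /t3; lra.
pose b1 := (a - t1) / eta; pose b2 := (a - t2) / eta.
(* [rho] is small enough for the exponents [k1], [k2], [kw] to be positive. *)
pose rho := t1 * t2 * t3 / (1 + a); pose th := eta * (1 + rho).
have rho0 : 0 < rho by rewrite !(divr_gt0, mulr_gt0)// addr_gt0.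
have rhoE : rho * (1 + a) = t1 * t2 * t3.
  by rewrite /rho divfK// gt_eqF// addr_gt0.
have k1E : a - th * b1 = t1 - rho * (a - t1).
  by rewrite /th /b1; field; rewrite gt_eqF.
have k2E : a - th * b2 = t2 - rho * (a - t2).
  by rewrite /th /b2; field; rewrite gt_eqF.
have kvE : th * (1 + b1 + b2) - 2 * a = 2 * a * rho.
  by rewrite /th /b1 /b2 /eta; field; rewrite gt_eqF.
have small t : 0 < t -> rho * (a - t) < rho * (1 + a).
  by move=> t0; rewrite ltr_pM2l//; lra.
have k10 : 0 < a - th * b1.
  rewrite k1E subr_gt0; apply: lt_trans (small _ t10) _.
  by rewrite rhoE -mulrA gtr_pMr// mulr_ilt1// ltW.
have k20 : 0 < a - th * b2.
  rewrite k2E subr_gt0; apply: lt_trans (small _ t20) _.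
  by rewrite rhoE (mulrC t1) -mulrA gtr_pMr// mulr_ilt1// ltW.
have kw0 : 0 < 1 - th.
  rewrite /th (_ : 1 - _ = t3 - eta * rho); last by rewrite /t3; ring.
  rewrite subr_gt0; apply: (@le_lt_trans _ _ (rho * (1 + a))).
    by rewrite mulrC ler_pM2l//; have : eta < 1 := eta1; lra.
  by rewrite rhoE mulrC gtr_pMr// mulr_ilt1// ltW.
have kv0 : 0 < th * (1 + b1 + b2) - 2 * a.
  by rewrite kvE; apply: mulr_gt0 => //; apply: mulr_gt0.
set k1 := a - th * b1 in k10 k1E; set k2 := a - th * b2 in k20 k2E.
set kw := 1 - th in kw0; set kv := th * (1 + b1 + b2) - 2 * a in kv0 kvE.
have kE : kw + k1 + k2 + kv = 1 by rewrite /kw /k1 /k2 /kv; ring.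
have th0 : 0 < th by rewrite mulr_gt0// addr_gt0.
pose r : R := 2^-1 `^ eta.
have r0 : 0 < r by rewrite powR_gt0// invr_gt0.
have r1 : r < 1.
  have one : 1 `^ eta = 1 :> R by rewrite powR1.
  by rewrite -[ltRHS]one gt0_ltr_powR ?nnegrE// invf_lt1// ltr1n.
have dk1 : d `^ kv < 1.
  have one : 1 `^ kv = 1 :> R by rewrite powR1.
  by rewrite -[ltRHS]one gt0_ltr_powR ?nnegrE// ltW.
pose K := 2 `^ th * (1 - d `^ kv)^-1.
have K0 : 0 < K by rewrite mulr_gt0 ?powR_gt0// invr_gt0 subr_gt0.
pose D t := ((1 - t / a)^-1 `^ (a / t)) `^ t.
have D0 t : 0 < t -> t < a -> 0 < D t.
  by move=> t0 ta; rewrite !powR_gt0// invr_gt0 subr_gt0 ltr_pdivrMr// mul1r.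
pose D3 := ((1 - t3)^-1 `^ (t3^-1)) `^ t3.
have D30 : 0 < D3 by rewrite !powR_gt0// invr_gt0 subr_gt0.
exists (K / (1 - r) * (D t1 * D t2 * D3)).
  by rewrite !mulr_gt0 ?D0// invr_gt0 subr_gt0.
move=> I le A e1 e2 ew ev x1 x2 y1 y2 W12 W1 W2 A0 W120 W10 W20 M eta_ t3_.
rewrite -/eta in eta_ t3_ *; rewrite {}/t3_ {}/eta_ -/t3 => H12 H13 H23.
case: M => leF e10 e20 ew0 ev0 x10 x20 y10 y20 xy1 xy2 sp HA.
pose V := down le ev; pose S1 := down le e1; pose S2 := down le e2.
pose w := down le ew.
have V0 i : 0 < V i by exact: down_gt0.
have S10 i : 0 < S1 i by exact: down_gt0.
have S20 i : 0 < S2 i by exact: down_gt0.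
have w0 i : 0 < w i by exact: down_gt0.
pose Ai i := w i / V i * (S1 i / V i) `^ b1 * (S2 i / V i) `^ b2.
have Ai0 i : 0 < Ai i by rewrite !mulr_gt0 ?powR_gt0 ?divr_gt0 ?invr_gt0.
have AiA i : Ai i <= A by exact: HA.
pose c i := V i * (w i / V i) * ((S1 i / V i) `^ a * (S2 i / V i) `^ a).
have c0 i : 0 <= c i by rewrite !mulr_ge0 ?powR_ge0 ?invr_ge0 ?ltW.
pose chat i := w i `^ kw * S1 i `^ k1 * S2 i `^ k2 * V i `^ kv.
have chat0 i : 0 <= chat i by rewrite !mulr_ge0 ?powR_ge0.
have cE i : c i = Ai i `^ th * chat i by exact: shell_identity.
have cE' i : c i = Ai i `^ eta * (S1 i `^ t1 * S2 i `^ t2 * w i `^ t3).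
  rewrite /c (shell_identity a b1 b2 eta)//; congr (_ * _).
  have -> : eta * (1 + b1 + b2) - 2 * a = 0.
    by rewrite /b1 /b2 /eta; field; rewrite gt_eqF.
  have -> : a - eta * b1 = t1 by rewrite /b1; field; rewrite gt_eqF.
  have -> : a - eta * b2 = t2 by rewrite /b2; field; rewrite gt_eqF.
  by rewrite powRr0 mulr1 -/t3 -mulrA mulrC.
have /choice[sh shP] i : exists n, 2^-1 ^+ n.+1 < Ai i / A /\ Ai i / A <= 2^-1 ^+ n :> R.
  by apply: exp_shell; rewrite ?divr_gt0// ler_pdivrMr// mul1r.
pose N := (\max_i sh i).+1.
have shN i : (sh i < N)%N by rewrite ltnS; exact: leq_bigmax.
pose sh' i := Ordinal (shN i).
pose g1 i := (down le x1 i / S1 i) `^ a.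
pose g2 i := (down le x2 i / S2 i) `^ a.
pose G i := \sum_(j | le i j) coef le a ev x1 x2 j.
have coef0 i : 0 <= coef le a ev x1 x2 i by rewrite mulr_ge0 ?powR_ge0.
have G0 i : 0 <= G i by exact: sumr_ge0.
pose q := eta^-1.
pose x3 i := ew i * G i `^ (q - 1).
have x30 i : 0 <= x3 i by rewrite mulr_ge0 ?powR_ge0 ?ltW.
pose g3 i := down le x3 i / w i.
pose y3 i := ew i * G i `^ q.
have y30 i : 0 <= y3 i by rewrite mulr_ge0 ?powR_ge0 ?ltW.
have q1 : 1 < q by rewrite invf_gt1.
have qt3 : q * t3 = q - 1 by rewrite /q /t3; field; rewrite gt_eqF.
pose Z := \sum_i y3 i.
have Z0 : 0 <= Z by exact: sumr_ge0.
have ZE : Z = \sum_i c i * (g1 i * g2 i * g3 i).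
  have -> : Z = \sum_i x3 i * G i.
    apply: eq_bigr => i _; rewrite /y3 /x3 -mulrA; congr (_ * _).
    by rewrite mulrC mulr_powRB1// (lt_trans _ q1).
  rewrite /G; under eq_bigr do rewrite mulr_sumr.
  rewrite (exchange_big_dep xpredT)//=; apply: eq_bigr => j _.
  rewrite -mulr_suml -/(down le x3 j) mulrC /coef /g3.
  have E x s1 : 0 <= x -> 0 < s1 -> (x / V j) `^ a = (s1 / V j) `^ a * (x / s1) `^ a.
    move=> x0 s10; have -> : x / V j = s1 / V j * (x / s1).
      by field; rewrite !gt_eqF ?V0.
    by rewrite powRM// divr_ge0// ltW.
  rewrite (E (down le x1 j) (S1 j)) ?down_ge0//.
  rewrite (E (down le x2 j) (S2 j)) ?down_ge0// /c /g1 /g2.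
  have := V0 j; have := w0 j; move: (w j) (V j) => w' v' w'0 v'0.
  by field; rewrite !gt_eqF.
have g10 i : 0 <= g1 i by exact: powR_ge0.
have g20 i : 0 <= g2 i by exact: powR_ge0.
have g30 i : 0 <= g3 i by apply: divr_ge0; [exact: down_ge0|exact: ltW].
pose Ws := W12 `^ eta + W2 `^ (t1 + t3) + W1 `^ (t2 + t3).
have Ws0 : 0 <= Ws by rewrite !addr_ge0 ?powR_ge0.
pose N1 := \sum_i e1 i * star le g1 i `^ t1^-1.
pose N2 := \sum_i e2 i * star le g2 i `^ t2^-1.
pose N3 := \sum_i ew i * star le g3 i `^ t3^-1.
pose NN := N1 `^ t1 * N2 `^ t2 * N3 `^ t3.
have NN0 : 0 <= NN by rewrite !mulr_ge0 ?powR_ge0.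
have shell n : \sum_(i | sh' i == n) c i * (g1 i * g2 i * g3 i) <=
    K * (A * 2^-1 ^+ n) `^ eta * Ws * NN.
  have B0 : 0 <= A * 2^-1 ^+ n by rewrite mulr_ge0 ?exprn_ge0 ?invr_ge0// ltW.
  have JA j : sh' j == n -> Ai j <= A * 2^-1 ^+ n /\ A * 2^-1 ^+ n <= 2 * Ai j.
    move=> /eqP <- /=; have [lo hi] := shP j; split.
      by rewrite mulrC -ler_pdivrMr.
    by move: lo; rewrite exprS ltr_pdivlMr// => /dbl.
  apply: trilinear => //; rewrite ?(ltW K0) ?powR_ge0//; try by move=> i; exact: ltW.
  - by rewrite /t3 addrC subrK.
  - move=> j jn; have [hi lo] := JA j jn.
    apply: (@le_trans _ _ ((A * 2^-1 ^+ n) `^ th * down le chat j)).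
      rewrite /down mulr_sumr big_mkcondr; apply: ler_sum => i _.
      case: ifP => [/JA[iA _]|_]; last by rewrite mulr_ge0 ?powR_ge0.
      by rewrite cE; apply: ler_wpM2r => //; apply: powR_le => //; exact: ltW.
    apply: (@le_trans _ _ ((A * 2^-1 ^+ n) `^ th * ((1 - d `^ kv)^-1 * chat j))).
      rewrite ler_wpM2l ?powR_ge0//.
      exact: (kolmogorov leF j kw0 k10 k20 kv0 kE (ltW d0) d1 ew0 e10 e20 ev0 sp
        (fun i => erefl (chat i))).
    rewrite cE /K -!mulrA mulrCA [leRHS]mulrCA.
    apply: ler_wpM2l; first by rewrite invr_ge0 subr_ge0 ltW.
    rewrite [leRHS]mulrA; apply: ler_wpM2r => //.
    rewrite -powRM//; last exact: ltW.
    by apply: powR_le => //; exact: ltW.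
  - move=> j jn; have [hi lo] := JA j jn.
    rewrite cE'; apply: ler_wpM2r; first by rewrite !mulr_ge0 ?powR_ge0.
    by apply: powR_le => //; exact: ltW.
have ZK : Z <= K / (1 - r) * A `^ eta * Ws * NN.
  rewrite ZE (partition_big sh' xpredT)//=.
  apply: le_trans (ler_sum _ (fun n _ => shell n)) _.
  rewrite -!mulr_suml; apply: ler_wpM2r => //; apply: ler_wpM2r => //.
  rewrite -mulr_sumr -mulrA; apply: ler_wpM2l; first exact: ltW.
  have -> : \sum_(n < N) (A * 2^-1 ^+ n) `^ eta = A `^ eta * \sum_(n < N) r ^+ n.
    rewrite mulr_sumr; apply: eq_bigr => n _.
    rewrite powRM ?exprn_ge0 ?invr_ge0 ?ltW//; congr (_ * _).
    by rewrite powR_exprn// invr_ge0.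
  rewrite mulrC; apply: ler_wpM2r; first exact: powR_ge0.
  by apply: geometric_sum_le => //; exact: ltW.
have NNle : NN <= D t1 * D t2 * D3 *
    ((\sum_i y1 i) `^ t1 * (\sum_i y2 i) `^ t2) * Z `^ t3.
  have N1le : N1 `^ t1 <= D t1 * (\sum_i y1 i) `^ t1.
    rewrite /D -powRM ?powR_ge0 ?sumr_ge0//; apply: powR_le; first exact: ltW.
      by apply: sumr_ge0 => i _; rewrite mulr_ge0 ?powR_ge0 ?ltW.
    exact: doob_star.
  have N2le : N2 `^ t2 <= D t2 * (\sum_i y2 i) `^ t2.
    rewrite /D -powRM ?powR_ge0 ?sumr_ge0//; apply: powR_le; first exact: ltW.
      by apply: sumr_ge0 => i _; rewrite mulr_ge0 ?powR_ge0 ?ltW.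
    exact: doob_star.
  have N3le : N3 `^ t3 <= D3 * Z `^ t3.
    rewrite /D3 -powRM ?powR_ge0//; apply: powR_le; first exact: ltW.
      by apply: sumr_ge0 => i _; rewrite mulr_ge0 ?powR_ge0 ?ltW.
    have := @doob R I le leF ew x3 y3 t3^-1 _ ew0 x30 y30.
    rewrite !invrK; apply; first by rewrite invf_gt1.
    move=> i; rewrite /x3 /y3 (powRM _ (ltW (ew0 i)) (powR_ge0 _ _)).
    rewrite mulrAC -powRDx// (addrC t3) subrK (powRr1 (ltW (ew0 i))).
    by move: (G i) => g; rewrite -(powRrM g) qt3.
  rewrite -reorder2.
  by apply: ler_pM; rewrite ?mulr_ge0 ?powR_ge0//; apply: ler_pM; rewrite ?powR_ge0.
pose Y := (\sum_i y1 i) `^ t1 * (\sum_i y2 i) `^ t2.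
have Y0 : 0 <= Y by rewrite mulr_ge0 ?powR_ge0.
pose c1 := K / (1 - r) * (D t1 * D t2 * D3) * (A `^ eta * Ws * Y).
have Kr0 : 0 <= K / (1 - r) by apply: divr_ge0; rewrite ?subr_ge0; exact: ltW.
have DD0 : 0 <= D t1 * D t2 * D3 by rewrite ltW// !mulr_gt0 ?D0.
have AW0 : 0 <= A `^ eta * Ws by rewrite mulr_ge0 ?powR_ge0.
have c10 : 0 <= c1 := mulr_ge0 (mulr_ge0 Kr0 DD0) (mulr_ge0 AW0 Y0).
have KAW0 : 0 <= K / (1 - r) * A `^ eta * Ws by rewrite -mulrA; exact: mulr_ge0.
have Zc := le_trans ZK (ler_wpM2l KAW0 NNle).
rewrite reorder in Zc.
have etat : eta + t3 = 1 by rewrite /t3 addrC subrK.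
(* [Zc] has the form [Z <= c1 * Z `^ t3] with [t3 < 1]. *)
have := powR_absorb eta0 etat Z0 c10 Zc.
move: c10 => {Zc}; rewrite -/c1; move: c1 => c1 c10.
move=> /(powR_le (ltW eta0) Z0); rewrite -(powRrM c1) mulVf ?gt_eqF// powRr1//.
Qed.

End sparse_form.

Section sparse_form_le.
Context {R : realType}.
Implicit Types (a d t : R).

Lemma sparse_form_le a t1 t2 d : 0 < t1 -> t1 < a -> 0 < t2 -> t2 < a ->
  1 <= t1 + t2 -> exists2 C : R, 0 < C &
  forall (I : finType) (le : rel I) (A : R) (e1 e2 ew ev x1 x2 y1 y2 : I -> R)
    (W12 : R),
  0 < A -> 0 <= W12 ->
  sparse_model le d a t1 t2 A e1 e2 ew ev x1 x2 y1 y2 ->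
  let eta := t1 + t2 in
  pair_carleson le e1 e2 (t1 / eta) (t2 / eta) W12 ->
  (\sum_i ew i * (\sum_(j | le i j) coef le a ev x1 x2 j) `^ eta^-1) `^ eta <=
  C * (A `^ eta * W12 `^ eta
       * ((\sum_i y1 i) `^ t1 * (\sum_i y2 i) `^ t2)).
Proof.
have reorder (k l b c y z : R) :
  k * l * (b * c * (y * z)) = b * c * (k * y * (l * z)) by ring.
have alg (u1 u2 g h v z : R) : 0 < v ->
    u1 * g * (u2 * h) * z = v * (z / v) * (u1 * u2) * (g * h).
  by move=> v0; field; rewrite gt_eqF.
move=> t10 t1a t20 t2a eta1.
pose eta := t1 + t2.
have eta0 : 0 < eta by exact: addr_gt0.
have a0 : 0 < a by exact: lt_trans t1a.
pose b1 := (a - t1) / eta; pose b2 := (a - t2) / eta.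
pose D t := ((1 - t / a)^-1 `^ (a / t)) `^ t.
have D0 t : 0 < t -> t < a -> 0 < D t.
  by move=> t0 ta; rewrite !powR_gt0// invr_gt0 subr_gt0 ltr_pdivrMr// mul1r.
exists (D t1 * D t2); first by rewrite !mulr_gt0 ?D0.
move=> I le A e1 e2 ew ev x1 x2 y1 y2 W12 A0 W120 M eta_.
rewrite -/eta in eta_ *; rewrite {}/eta_ => H12.
case: M => leF e10 e20 ew0 ev0 x10 x20 y10 y20 xy1 xy2 _ HA.
pose V := down le ev; pose S1 := down le e1; pose S2 := down le e2.
pose w := down le ew.
have V0 i : 0 < V i by exact: down_gt0.
have S10 i : 0 < S1 i by exact: down_gt0.
have S20 i : 0 < S2 i by exact: down_gt0.
have w0 i : 0 < w i by exact: down_gt0.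
pose g1 i := (down le x1 i / S1 i) `^ a.
pose g2 i := (down le x2 i / S2 i) `^ a.
have g10 i : 0 <= g1 i by exact: powR_ge0.
have g20 i : 0 <= g2 i by exact: powR_ge0.
have coef0 i : 0 <= coef le a ev x1 x2 i by rewrite mulr_ge0 ?powR_ge0.
pose q := eta^-1.
have q0 : 0 < q by rewrite invr_gt0.
have q1 : q <= 1 by rewrite invf_le1.
pose Z := \sum_i ew i * (\sum_(j | le i j) coef le a ev x1 x2 j) `^ q.
have Z0 : 0 <= Z by apply: sumr_ge0 => i _; rewrite mulr_ge0 ?powR_ge0// ltW.
pose u j := S1 j `^ (t1 / eta) * S2 j `^ (t2 / eta).
pose G1 := fun i => star le g1 i `^ t1^-1.
pose G2 := fun i => star le g2 i `^ t2^-1.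
have u0 j : 0 <= u j by rewrite mulr_ge0 ?powR_ge0.
have term j : coef le a ev x1 x2 j `^ q * w j <=
    A * (u j * (G1 j `^ (t1 / eta) * G2 j `^ (t2 / eta))).
  have E x s1 : 0 <= x -> 0 < s1 ->
      ((x / V j) `^ a) `^ q = (s1 / V j) `^ (a * q) * ((x / s1) `^ a) `^ q.
    move=> x0 s10; rewrite -2!powRrM -powRM ?divr_ge0 ?(ltW s10) ?(ltW (V0 j))//.
    by congr (powR _ _); field; rewrite !gt_eqF ?V0.
  have -> : coef le a ev x1 x2 j `^ q * w j =
      (V j * (w j / V j) * ((S1 j / V j) `^ (a * q) * (S2 j / V j) `^ (a * q)))
      * (g1 j `^ q * g2 j `^ q).
    rewrite /coef (powRM q (powR_ge0 _ _) (powR_ge0 _ _)).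
    rewrite (E (down le x1 j) (S1 j)) ?down_ge0//.
    rewrite (E (down le x2 j) (S2 j)) ?down_ge0// -/(g1 j) -/(g2 j).
    exact: alg.
  rewrite (shell_identity (a * q) b1 b2 1)// powRr1; last first.
    by rewrite !mulr_ge0 ?powR_ge0 ?invr_ge0 ?ltW.
  rewrite subrr powRr0 !mul1r.
  have -> : 1 + b1 + b2 - 2 * (a * q) = 0.
    by rewrite /b1 /b2 /q /eta; field; rewrite gt_eqF.
  have -> : a * q - b1 = t1 / eta by rewrite /b1 /q; field; rewrite gt_eqF.
  have -> : a * q - b2 = t2 / eta by rewrite /b2 /q; field; rewrite gt_eqF.
  rewrite powRr0 mulr1 -/(u j) -mulrA; apply: ler_pM.
  - by rewrite !mulr_ge0 ?powR_ge0 ?invr_ge0 ?ltW.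
  - by rewrite !mulr_ge0 ?powR_ge0.
  - exact: HA.
  apply: ler_wpM2l; first exact: u0.
  have E' t g : 0 < t -> (g `^ t^-1) `^ (t / eta) = g `^ q.
    by move=> t0; rewrite -powRrM /q mulrA mulVf ?mul1r// gt_eqF.
  have EG1 : G1 j `^ (t1 / eta) = star le g1 j `^ q := E' _ _ t10.
  have EG2 : G2 j `^ (t2 / eta) = star le g2 j `^ q := E' _ _ t20.
  have m1 := powR_le (ltW q0) (g10 j) (star_ge leF g1 j).
  have m2 := powR_le (ltW q0) (g20 j) (star_ge leF g2 j).
  apply: ler_pM; [exact: powR_ge0|exact: powR_ge0| |].
    exact: (eq_ind_r (fun z => g1 j `^ q <= z) m1 EG1).
  exact: (eq_ind_r (fun z => g2 j `^ q <= z) m2 EG2).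
have ZA : Z <= A * \sum_j u j * (G1 j `^ (t1 / eta) * G2 j `^ (t2 / eta)).
  apply: (@le_trans _ _ (\sum_j coef le a ev x1 x2 j `^ q * w j)).
    apply: (@le_trans _ _ (\sum_i \sum_(j | le i j) ew i * coef le a ev x1 x2 j `^ q)).
      apply: ler_sum => i _; rewrite -mulr_sumr; apply: ler_wpM2l; first exact: ltW.
      exact: powR_sum_le.
    rewrite (exchange_big_dep xpredT)//=; apply: ler_sum => j _.
    by rewrite -mulr_suml mulrC.
  by rewrite mulr_sumr; apply: ler_sum.
pose N1 := \sum_i e1 i * G1 i; pose N2 := \sum_i e2 i * G2 i.
have ts : t1 / eta + t2 / eta = 1 by rewrite -mulrDl divff ?gt_eqF.
have am g t : 0 < t -> antitone le (fun i => star le g i `^ t^-1).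
  move=> t0; apply: antitone_powR; first by rewrite invr_ge0 ltW.
    by move=> i; exact: star_ge0.
  exact: antitone_star.
have emb : \sum_j u j * (G1 j `^ (t1 / eta) * G2 j `^ (t2 / eta)) <=
    W12 * (N1 `^ (t1 / eta) * N2 `^ (t2 / eta)) :=
  pair_embedding leF (divr_gt0 t10 eta0) (divr_gt0 t20 eta0) ts W120
  (fun i => ltW (e10 i)) (fun i => ltW (e20 i))
  (fun i => powR_ge0 (star le g1 i) t1^-1) (fun i => powR_ge0 (star le g2 i) t2^-1)
  (am g1 t1 t10) (am g2 t2 t20) H12.
have N10 : 0 <= N1 by apply: sumr_ge0 => i _; rewrite mulr_ge0 ?powR_ge0// ltW.
have N20 : 0 <= N2 by apply: sumr_ge0 => i _; rewrite mulr_ge0 ?powR_ge0// ltW.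
have {ZA}ZA : Z `^ eta <= A `^ eta * W12 `^ eta * (N1 `^ t1 * N2 `^ t2).
  have etaN0 : eta != 0 by rewrite gt_eqF.
  move: N1 N2 N10 N20 emb => N1' N2' N10 N20 emb.
  have PE := powR_pairE N1' N2' t1 t2 etaN0.
  rewrite -{}PE -!powRM ?mulr_ge0 ?powR_ge0 ?(ltW A0)//.
  apply: powR_le; [exact: ltW|exact: Z0|apply: le_trans ZA _].
  by rewrite -mulrA; apply: ler_wpM2l; [exact: ltW|exact: emb].
apply: le_trans ZA _; rewrite reorder; apply: ler_wpM2l.
  by rewrite mulr_ge0 ?powR_ge0.
have Nle N t (Y : R) : 0 < t -> 0 <= N -> 0 <= Y ->
    N <= (1 - t / a)^-1 `^ (a / t) * Y -> N `^ t <= D t * Y `^ t.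
  move=> t0 N0 Y0 NY; rewrite /D -powRM ?powR_ge0//.
  by apply: powR_le => //; exact: ltW.
apply: ler_pM; [exact: powR_ge0|exact: powR_ge0| |].
  apply: Nle => //; [exact: sumr_ge0|].
  exact: (doob_star leF t10 t1a e10 x10 y10 xy1).
apply: Nle => //; [exact: sumr_ge0|].
exact: (doob_star leF t20 t2a e20 x20 y20 xy2).
Qed.

End sparse_form_le.

Section discrete_estimate.
Context {R : realType}.

Lemma conj_expE (r : R) : 1 < r -> conj_exp r = r / (r - 1).
Proof.
move=> r1; rewrite /conj_exp /hoelder_conjugate/= eqe gt_eqF ?(lt_trans ltr01)//=.
by rewrite inver subr_eq0 gt_eqF.
Qed.

Lemma powR_sum3_le (x y z s : R) : 0 <= s -> 0 <= x -> 0 <= y -> 0 <= z ->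
  (x + y + z) `^ s <= 3 `^ s * (x `^ s + y `^ s + z `^ s).
Proof.
move=> s0 x0 y0 z0.
pose m := Num.max x (Num.max y z).
have xm : (x <= m) by rewrite le_max lexx.
have ym : (y <= m) by rewrite !le_max lexx orbT.
have zm : (z <= m) by rewrite !le_max lexx !orbT.
have m0 : (0 <= m) by exact: le_trans xm.
apply: (@le_trans _ _ ((3 * m) `^ s)).
  by apply: powR_le => //; rewrite ?addr_ge0//; lra.
rewrite powRM//; apply: ler_wpM2l; first exact: powR_ge0.
have [->|[->|->]] : m = x \/ m = y \/ m = z.
  rewrite /m; case: (leP x (Num.max y z)) => _; last by left.
  by right; case: (leP y z) => _; [right|left].
- by rewrite -addrA lerDl addr_ge0// powR_ge0.
- by rewrite addrAC lerDr addr_ge0// powR_ge0.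
- by rewrite lerDr addr_ge0// powR_ge0.
Qed.

Lemma powR_root_le (X C0 A U Y1 Y2 eta t1 t2 g : R) :
  0 <= X -> 0 <= C0 -> 0 <= A -> 0 <= U -> 0 <= Y1 -> 0 <= Y2 -> 0 <= g ->
  X `^ eta <= C0 * (A `^ eta * U * (Y1 `^ t1 * Y2 `^ t2)) ->
  X `^ (eta * g) <=
  C0 `^ g * (A `^ (eta * g) * U `^ g) * Y1 `^ (t1 * g) * Y2 `^ (t2 * g).
Proof.
move=> X0 C00 A0 U0 Y10 Y20 g0 H.
rewrite (powRrM X) (powRrM A) (powRrM Y1) (powRrM Y2).
have := powR_le g0 (powR_ge0 _ _) H.
have := powR_ge0 A eta; have := powR_ge0 Y1 t1; have := powR_ge0 Y2 t2.
move: (A `^ eta) (Y1 `^ t1) (Y2 `^ t2) => a y1 y2 y20 y10 a0.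
rewrite (powRM g C00); last by rewrite !mulr_ge0.
rewrite (powRM g (mulr_ge0 a0 U0) (mulr_ge0 y10 y20)).
by rewrite (powRM g a0 U0) (powRM g y10 y20) !mulrA.
Qed.

Lemma discrete_estimate (gamma p0 p1 p2 p d : R) :
  0 < gamma -> 1 <= p0 -> p0 < p1 -> p0 < p2 -> p^-1 = p1^-1 + p2^-1 ->
  0 < d -> d < 1 -> exists2 C : R, 0 < C &
  forall (I : finType) (le : rel I) (A : R) (e1 e2 ew ev x1 x2 y1 y2 : I -> R)
    (W12 W1 W2 : R),
  0 < A -> 0 <= W12 -> 0 <= W1 -> 0 <= W2 ->
  sparse_model le d (gamma / p0) (gamma / p1) (gamma / p2) A
    e1 e2 ew ev x1 x2 y1 y2 ->
  pair_carleson le e1 e2 (p / p1) (p / p2) (W12 / (1 - d)) ->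
  (gamma < p -> pair_carleson le ew e2
    (conj_exp (p1 / gamma) / conj_exp (p / gamma))
    (conj_exp (p1 / gamma) / (p2 / gamma)) (W1 / (1 - d))) ->
  (gamma < p -> pair_carleson le ew e1
    (conj_exp (p2 / gamma) / conj_exp (p / gamma))
    (conj_exp (p2 / gamma) / (p1 / gamma)) (W2 / (1 - d))) ->
  (\sum_i ew i * (\sum_(j | le i j) coef le (gamma / p0) ev x1 x2 j)
       `^ (p / gamma)) `^ p^-1 <=
  C * A `^ p^-1 * (W12 `^ p^-1 +
    (W1 `^ (gamma * conj_exp (p1 / gamma))^-1
     + W2 `^ (gamma * conj_exp (p2 / gamma))^-1))
  * (\sum_i y1 i) `^ p1^-1 * (\sum_i y2 i) `^ p2^-1.
Proof.
move=> g0 p01 p01lt p02lt pE d0 d1.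
have p00 : 0 < p0 by exact: lt_le_trans p01.
have p10 : 0 < p1 by exact: lt_trans p01lt.
have p20 : 0 < p2 by exact: lt_trans p02lt.
have p_gt0 : 0 < p by rewrite -invr_gt0 pE addr_gt0// invr_gt0.
pose t1 := gamma / p1; pose t2 := gamma / p2; pose a := gamma / p0.
have t10 : 0 < t1 by exact: divr_gt0.
have t20 : 0 < t2 by exact: divr_gt0.
have t1a : t1 < a by rewrite ltr_pM2l// ltf_pV2.
have t2a : t2 < a by rewrite ltr_pM2l// ltf_pV2.
have etaE : t1 + t2 = gamma / p by rewrite -mulrDr -pE.
have eta_inv : (t1 + t2)^-1 = p / gamma by rewrite etaE invf_div.
pose g := gamma^-1.
have g_ge0 : 0 <= g by rewrite invr_ge0 ltW.
have etag : (t1 + t2) * g = p^-1.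
  by rewrite etaE mulrAC divff ?mul1r// gt_eqF.
have t1g : t1 * g = p1^-1 by rewrite /t1 mulrAC divff ?mul1r// gt_eqF.
have t2g : t2 * g = p2^-1 by rewrite /t2 mulrAC divff ?mul1r// gt_eqF.
have frac1 : p / p1 = t1 / (t1 + t2).
  by rewrite eta_inv /t1; field; rewrite !gt_eqF.
have frac2 : p / p2 = t2 / (t1 + t2).
  by rewrite eta_inv /t2; field; rewrite !gt_eqF.
pose k := (1 - d)^-1.
have k0 : 0 <= k by rewrite invr_ge0 subr_ge0 ltW.
have kp : 0 < k by rewrite invr_gt0 subr_gt0.
pose E1 := (gamma * conj_exp (p1 / gamma))^-1.
pose E2 := (gamma * conj_exp (p2 / gamma))^-1.
pose K := k `^ p^-1 + k `^ E1 + k `^ E2.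
have K0 : 0 < K by rewrite !addr_gt0 ?powR_gt0.
have Kp : k `^ p^-1 <= K by rewrite /K -addrA lerDl addr_ge0 ?powR_ge0.
have K1 : k `^ E1 <= K by rewrite /K addrAC lerDr addr_ge0 ?powR_ge0.
have K2 : k `^ E2 <= K by rewrite /K lerDr addr_ge0 ?powR_ge0.
have Wk (W E : R) : 0 <= W -> k `^ E <= K -> (W / (1 - d)) `^ E <= K * W `^ E.
  by move=> W0 kE; rewrite powRM// mulrC ler_wpM2r// powR_ge0.
have [gp|pg] := ltP gamma p.
- have eta1 : t1 + t2 < 1 by rewrite etaE ltr_pdivrMr// mul1r.
  have r11 : 1 < p1 / gamma.
    rewrite ltr_pdivlMr// mul1r; apply: lt_trans gp _.
    by rewrite -ltf_pV2// pE ltrDl invr_gt0.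
  have r21 : 1 < p2 / gamma.
    rewrite ltr_pdivlMr// mul1r; apply: lt_trans gp _.
    by rewrite -ltf_pV2// pE ltrDr invr_gt0.
  have q1 : 1 < p / gamma by rewrite ltr_pdivlMr// mul1r.
  have sub1 : 0 < p1 - gamma by move: r11; rewrite ltr_pdivlMr// mul1r subr_gt0.
  have sub2 : 0 < p2 - gamma by move: r21; rewrite ltr_pdivlMr// mul1r subr_gt0.
  have subp : 0 < p - gamma by rewrite subr_gt0.
  have pEl : p = p1 * p2 / (p1 + p2).
    by rewrite -[LHS]invrK pE; field; rewrite !gt_eqF// addr_gt0.
  pose t3 := 1 - (t1 + t2).
  have [C0 C00 HC] := sparse_form_gt t10 t1a t20 t2a eta1 d0 d1.
  exists (C0 `^ g * 3 `^ g * K); first by rewrite !mulr_gt0 ?powR_gt0.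
  move=> I le A e1 e2 ew ev x1 x2 y1 y2 W12 W1 W2 A0 W120 W10 W20 M H12 H1 H2.
  have {}H1 := H1 isT; have {}H2 := H2 isT.
  rewrite !conj_expE// in H1 H2; move: H1 H2.
  have -> : p1 / gamma / (p1 / gamma - 1) / (p / gamma / (p / gamma - 1)) =
      t3 / (t2 + t3).
    rewrite /t3 etaE /t2 (_ : gamma / p2 + (1 - gamma / p) = 1 - gamma / p1).
      by field; rewrite ?mulN1r !gt_eqF.
    by rewrite -etaE /t1 /t2; ring.
  have -> : p1 / gamma / (p1 / gamma - 1) / (p2 / gamma) = t2 / (t2 + t3).
    rewrite /t3 etaE /t2 (_ : gamma / p2 + (1 - gamma / p) = 1 - gamma / p1).
      by field; rewrite ?mulN1r !gt_eqF.
    by rewrite -etaE /t1 /t2; ring.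
  have -> : p2 / gamma / (p2 / gamma - 1) / (p / gamma / (p / gamma - 1)) =
      t3 / (t1 + t3).
    rewrite /t3 etaE /t1 (_ : gamma / p1 + (1 - gamma / p) = 1 - gamma / p2).
      by field; rewrite ?mulN1r !gt_eqF.
    by rewrite -etaE /t1 /t2; ring.
  have -> : p2 / gamma / (p2 / gamma - 1) / (p1 / gamma) = t1 / (t1 + t3).
    rewrite /t3 etaE /t1 (_ : gamma / p1 + (1 - gamma / p) = 1 - gamma / p2).
      by field; rewrite ?mulN1r !gt_eqF.
    by rewrite -etaE /t1 /t2; ring.
  move=> /pair_carlesonC H1 /pair_carlesonC H2.
  rewrite frac1 frac2 in H12.
  have W0 W : 0 <= W -> 0 <= W / (1 - d) by move=> W0; rewrite mulr_ge0.
  have := HC I le A e1 e2 ew ev x1 x2 y1 y2 _ _ _ A0 (W0 _ W120) (W0 _ W10)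
    (W0 _ W20) M H12 H2 H1.
  rewrite eta_inv => H.
  case: M => _ _ _ ew0 _ _ _ y10 y20 _ _ _ _.
  have Y10 : 0 <= \sum_i y1 i by exact: sumr_ge0.
  have Y20 : 0 <= \sum_i y2 i by exact: sumr_ge0.
  have U0 : 0 <= (W12 / (1 - d)) `^ (t1 + t2) + (W2 / (1 - d)) `^ (t1 + t3)
      + (W1 / (1 - d)) `^ (t2 + t3) by rewrite !addr_ge0 ?powR_ge0.
  have X0 : 0 <= \sum_i ew i * (\sum_(j | le i j) coef le a ev x1 x2 j) `^ (p / gamma).
    by apply: sumr_ge0 => i _; rewrite mulr_ge0 ?powR_ge0// ltW.
  have E1E : (t2 + t3) * g = E1.
    rewrite /E1 conj_expE// /g (_ : t2 + t3 = 1 - gamma / p1).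
      by field; rewrite ?mulN1r !gt_eqF.
    by rewrite /t3 /t1; ring.
  have E2E : (t1 + t3) * g = E2.
    rewrite /E2 conj_expE// /g (_ : t1 + t3 = 1 - gamma / p2).
      by field; rewrite ?mulN1r !gt_eqF.
    by rewrite /t3 /t2; ring.
  have Ug : ((W12 / (1 - d)) `^ (t1 + t2) + (W2 / (1 - d)) `^ (t1 + t3)
      + (W1 / (1 - d)) `^ (t2 + t3)) `^ g
      <= 3 `^ g * (K * (W12 `^ p^-1 + (W1 `^ E1 + W2 `^ E2))).
    apply: le_trans (powR_sum3_le g_ge0 _ _ _) _; try exact: powR_ge0.
    apply: ler_wpM2l; first exact: powR_ge0.
    rewrite -(powRrM (W12 / (1 - d))) -(powRrM (W2 / (1 - d))).
    rewrite -(powRrM (W1 / (1 - d))) etag E1E E2E -addrA.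
    rewrite mulrDr mulrDr [X in _ + X]addrC.
    by apply: lerD; [exact: Wk|apply: lerD; exact: Wk].
  have := powR_root_le X0 (ltW C00) (ltW A0) U0 Y10 Y20 g_ge0 H.
  rewrite etag t1g t2g => /le_trans; apply.
  apply: ler_wpM2r; first exact: powR_ge0.
  apply: ler_wpM2r; first exact: powR_ge0.
  have Ug' := ler_wpM2l (mulr_ge0 (powR_ge0 C0 g) (powR_ge0 A p^-1)) Ug.
  rewrite [leLHS]mulrA; apply: le_trans Ug' _.
  by rewrite le_eqVlt; apply/orP; left; apply/eqP; rewrite -/E1 -/E2; ring.
- have eta1 : 1 <= t1 + t2 by rewrite etaE ler_pdivlMr// mul1r.
  have [C0 C00 HC] := sparse_form_le d t10 t1a t20 t2a eta1.
  exists (C0 `^ g * K); first by rewrite !mulr_gt0 ?powR_gt0.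
  move=> I le A e1 e2 ew ev x1 x2 y1 y2 W12 W1 W2 A0 W120 W10 W20 M H12 _ _.
  rewrite frac1 frac2 in H12.
  have W0 : 0 <= W12 / (1 - d) by rewrite mulr_ge0.
  have := HC I le A e1 e2 ew ev x1 x2 y1 y2 _ A0 W0 M H12.
  rewrite eta_inv => H.
  case: M => _ _ _ ew0 _ _ _ y10 y20 _ _ _ _.
  have Y10 : 0 <= \sum_i y1 i by exact: sumr_ge0.
  have Y20 : 0 <= \sum_i y2 i by exact: sumr_ge0.
  have X0 : 0 <= \sum_i ew i * (\sum_(j | le i j) coef le a ev x1 x2 j) `^ (p / gamma).
    by apply: sumr_ge0 => i _; rewrite mulr_ge0 ?powR_ge0// ltW.
  have U0 := powR_ge0 (W12 / (1 - d)) (t1 + t2).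
  have := powR_root_le X0 (ltW C00) (ltW A0) U0 Y10 Y20 g_ge0 H.
  rewrite -(powRrM (W12 / (1 - d))) etag t1g t2g => /le_trans; apply.
  apply: ler_wpM2r; first exact: powR_ge0.
  apply: ler_wpM2r; first exact: powR_ge0.
  rewrite -[in leRHS]mulrA [in leRHS]mulrACA -!mulrA.
  apply: ler_wpM2l; first exact: powR_ge0.
  apply: ler_wpM2l; first exact: powR_ge0.
  apply: le_trans (Wk _ _ W120 Kp) _; apply: ler_wpM2l; first exact: ltW.
  by rewrite lerDl addr_ge0 ?powR_ge0.
Qed.

End discrete_estimate.

Local Open Scope classical_set_scope.
Local Open Scope ring_scope.
Local Open Scope ereal_scope.

(** * From integrals to sums over cores *)

Section measure_facts.
Context d (T : measurableType d) (R : realType).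
Variable mu : {measure set T -> \bar R}.
Implicit Types (D E : set T) (f g : T -> R).

(* Without measurability: this spares that of the maximal function and of the
   sparse operator. *)
Lemma ge0_le_integral_nonmeasurable E (f g : T -> \bar R) :
  (forall x, E x -> 0 <= f x) -> (forall x, E x -> f x <= g x) ->
  \int[mu]_(x in E) f x <= \int[mu]_(x in E) g x.
Proof.
move=> f0 fg; have g0 x : E x -> 0 <= g x.
  by move=> Ex; apply: le_trans (f0 _ Ex) (fg _ Ex).
rewrite !ge0_integralE//; apply: ge_ereal_sup => _ [h/= hf <-].
apply: ereal_sup_ubound; exists h => //= x; apply: le_trans (hf x) _.
exact: lee_restrict.
Qed.

Lemma integral_gt0 E f : measurable E -> 0 < mu E -> measurable_fun E f ->
  (forall x, E x -> (0 < f x)%R) -> 0 < \int[mu]_(x in E) (f x)%:E.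
Proof.
move=> mE E0 mf f0; rewrite lt0e integral_ge0 ?andbT; last first.
  by move=> x Ex; rewrite lee_fin ltW// f0.
apply/negP => /eqP I0.
have mEf : measurable_fun E (fun x => (f x)%:E) by exact/measurable_EFinP.
have : \int[mu]_(x in E) `|(f x)%:E| = 0.
  by rewrite -I0; apply: eq_integral => x /[!inE] Ex /=; rewrite gtr0_norm// f0.
move=> /(ae_eq_integral_abs mu mE mEf)[N [mN N0 EN]].
have /(le_measure mu) : E `<=` N.
  move=> x Ex; apply: EN => /= /(_ Ex)[] fx0; have := f0 _ Ex.
  by rewrite fx0 ltxx.
rewrite !inE => /(_ mE mN).
by rewrite [X in _ <= X]N0 leNgt E0.
Qed.

Lemma hoelder_set E f g (s t : R) : measurable E ->
  measurable_fun setT f -> measurable_fun setT g ->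
  (forall x, (0 <= f x)%R) -> (forall x, (0 <= g x)%R) ->
  (0 < s)%R -> (0 < t)%R -> (s + t = 1)%R ->
  \int[mu]_(x in E) (f x `^ s * g x `^ t)%:E <=
  (\int[mu]_(x in E) (f x)%:E) `^ s * (\int[mu]_(x in E) (g x)%:E) `^ t.
Proof.
move=> mE mf mg f0 g0 s0 t0 st.
have mfE (h : T -> R) : measurable_fun setT h -> measurable_fun setT (h \_ E).
  by move=> mh; apply/(measurable_restrictT _ mE).1; exact: measurable_funTS.
have mp (h : T -> R) (r : R) : measurable_fun setT h ->
    measurable_fun setT (fun x => (h \_ E) x `^ r)%R.
  by move=> /mfE mh; exact: measurableT_comp (measurable_powR r) mh.
have st' : (s^-1^-1 + t^-1^-1 = 1)%R by rewrite !invrK.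
have := @hoelder _ T R mu _ _ s^-1 t^-1 (mp f s mf) (mp g t mg) _ _ st'.
rewrite !invr_gt0 => /(_ s0 t0).
have N (h : T -> R) r : (0 < r)%R -> (forall x, 0 <= h x)%R ->
    'N[mu]_(r^-1)%:E[EFin \o (fun x => (h \_ E) x `^ r)%R] =
    (\int[mu]_(x in E) (h x)%:E) `^ r.
  move=> r0 h0; rewrite unlock invrK; congr (_ `^ _).
  rewrite [RHS]integral_mkcond; apply: eq_integral => x _ /=.
  rewrite restrict_EFin/= ger0_norm ?powR_ge0// -powRrM divff ?gt_eqF// powRr1//.
  by rewrite patchE; case: ifP.
rewrite !N// Lnorm1; apply: le_trans.
rewrite le_eqVlt; apply/orP; left; apply/eqP.
rewrite integral_mkcond; apply: eq_integral => x _ /=.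
rewrite restrict_EFin/= !patchE; case: ifP => _.
  by rewrite ger0_norm// mulr_ge0 ?powR_ge0.
by rewrite !powR0 ?gt_eqF// mulr0 normr0.
Qed.

End measure_facts.

Section partition.
Context d (T : measurableType d) (R : realType).
Variable mu : {measure set T -> \bar R}.
Context {I : finType}.
Variable Q : I -> set T.
Hypothesis mQ : forall i, measurable (Q i).
Hypothesis Q0 : forall i, Q i !=set0.
Hypothesis Qinj : injective Q.
Hypothesis nestedQ : forall i j, Q i `&` Q j !=set0 -> Q i `<=` Q j \/ Q j `<=` Q i.
Implicit Types i j : I.

Definition subcube i j := `[< Q i `<=` Q j >].

Definition core i := Q i `\` \bigcup_(j in [set j | ~~ subcube i j]) Q j.

Lemma subcube_forest : forest subcube.
Proof.
split.
- by move=> i; apply/asboolP.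
- move=> i j /andP[/asboolP ij /asboolP ji]; apply: Qinj; exact/seteqP.
- by move=> j i k /asboolP ij /asboolP jk; apply/asboolP; exact: subset_trans jk.
- move=> i j k /asboolP ij /asboolP ik; have [x Qx] := Q0 i.
  have : Q j `&` Q k !=set0 by exists x; split; [exact: ij|exact: ik].
  by move=> /nestedQ[?|?]; apply/orP; [left|right]; apply/asboolP.
Qed.

Lemma measurable_core i : measurable (core i).
Proof. by apply: measurableD => //; apply: fin_bigcup_measurable. Qed.

Lemma core_sub i : core i `<=` Q i. Proof. by move=> x []. Qed.

Lemma coreP i x : core i x <-> Q i x /\ forall j, Q j x -> subcube i j.
Proof.
split=> [[Qix nx]|[Qix H]]; split=> //.
  by move=> j Qjx; apply/negPn/negP => nij; apply: nx; exists j.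
by move=> [j /= nij /H]; rewrite (negbTE nij).
Qed.

Lemma core_disj i j x : core i x -> core j x -> i = j.
Proof.
move=> /coreP[ix iH] /coreP[jx jH]; have [_ a _ _] := subcube_forest.
by apply: a; rewrite iH// jH.
Qed.

Lemma core_cover j x : Q j x -> exists2 i, subcube i j & core i x.
Proof.
move=> Qjx; have [lxx la lt lc] := subcube_forest.
pose P i := `[< Q i x >].
have Pj : P j by exact/asboolP.
case: (arg_minnP (fun i => #|[pred k | subcube k i]|) Pj) => i /asboolP Qix imin.
have iH k : Q k x -> subcube i k.
  move=> Qkx; have [|/asboolP//|/asboolP ki] := @nestedQ i k; first by exists x.
  have [ik|nik] := boolP (subcube i k); first exact.
  have ki' : Q k `<=` Q i by exact/asboolP.
  have : P k by exact/asboolP.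
  move=> /imin; rewrite leqNgt => /negP[]; apply: proper_card; apply/properP.
  split.
    apply/fintype.subsetP => l /asboolP lk; apply/asboolP => z Qlz.
    exact: ki' (lk _ Qlz).
  by exists i; [exact/asboolP|exact: nik].
by exists i; [exact: iH|apply/coreP].
Qed.

Lemma Q_core j : Q j = \big[setU/set0]_(i <- [seq i <- enum I | subcube i j]) core i.
Proof.
rewrite -bigcup_seq; apply/seteqP; split=> [x /core_cover[i ij ix]|x [i]] /=.
  by exists i => //=; rewrite mem_filter ij mem_enum.
by rewrite mem_filter => /andP[/asboolP ij _] /core_sub/ij.
Qed.

Lemma trivIset_core (A : set I) : trivIset A core.
Proof.
by apply/trivIsetP => i j _ _ /eqP ij; apply/seteqP; split=> // x [/core_disj] /[apply].
Qed.

Lemma integral_down j (f : T -> \bar R) : measurable_fun (Q j) f ->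
  (forall x, 0 <= f x) ->
  \int[mu]_(x in Q j) f x = \sum_(i | subcube i j) \int[mu]_(x in core i) f x.
Proof.
move=> mf f0; rewrite Q_core ge0_integral_bigsetU//.
- by rewrite big_filter big_enum_cond.
- exact: measurable_core.
- by rewrite filter_uniq// enum_uniq.
- exact: trivIset_core.
- by rewrite -Q_core.
Qed.

Lemma integral_cores (f : T -> \bar R) : measurable_fun setT f ->
  (forall x, 0 <= f x) -> (forall x, (forall i, ~ Q i x) -> f x = 0) ->
  \int[mu]_x f x = \sum_i \int[mu]_(x in core i) f x.
Proof.
move=> mf f0 fQ.
have -> : \int[mu]_x f x =
    \int[mu]_(x in \big[setU/set0]_(i <- enum I) core i) f x.
  rewrite [RHS]integral_mkcond; apply: eq_integral => x _.
  rewrite patchE; case: ifPn => //; rewrite notin_setE -bigcup_seq => nx.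
  apply: fQ => i /core_cover[j _ jx]; apply: nx; exists j => //=.
  by rewrite mem_enum.
rewrite ge0_integral_bigsetU//; first by rewrite big_enum.
- exact: measurable_core.
- exact: enum_uniq.
- exact: trivIset_core.
- exact: measurable_funTS.
Qed.

Lemma sum_integral_cores_le (f : T -> \bar R) : measurable_fun setT f ->
  (forall x, 0 <= f x) ->
  \sum_i \int[mu]_(x in core i) f x <= \int[mu]_x f x.
Proof.
move=> mf f0; rewrite -big_enum/= -(@ge0_integral_bigsetU _ _ _ mu)//.
- apply: ge0_subset_integral => //.
  by apply: bigsetU_measurable => i _; exact: measurable_core.
- exact: measurable_core.
- exact: enum_uniq.
- exact: trivIset_core.
- exact: measurable_funTS.
Qed.

End partition.

(** * Dyadic cubes *)

Section cube_facts.
Context {R : realType}.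

Lemma measurable_cube n (a : euclid R n) (l : R) : measurable (cube a l).
Proof.
have -> : cube a l = \bigcap_(i in [set: 'I_n])
    ((@tnth n R)^~ i) @^-1` `[tnth a i, (tnth a i + l)%R[%classic.
  apply/seteqP; split=> [x ax i _ /=|x ax i]; first by rewrite in_itv/=; exact: ax.
  by have := ax i Logic.I; rewrite /= in_itv.
apply: fin_bigcap_measurable => // i _.
rewrite -[X in measurable X]setTI; exact: measurable_tnth.
Qed.

Lemma volume_cube n (a : euclid R n) (l : R) : (0 <= l)%R ->
  volume (cube a l) = (l ^+ n)%:E.
Proof.
move=> l0; elim: n a => [|n IH] a.
  rewrite /volume/= diracE mem_set// => -[]//.
rewrite /= /cons_measure /pushforward.
have -> : cons_pair @^-1` cube a l =
    `[thead a, (thead a + l)%R[%classic `*` cube [tuple of behead a] l.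
  apply/seteqP; split=> [[x y] H|[x y] [/= Hx Hy] i].
    split; first by have := H ord0; rewrite /= in_itv.
    move=> i; have := H (lift ord0 i); rewrite !tnth_behead.
    by rewrite !(tnth_nth 0%R) /= !inordK//= ltnS.
  case: (unliftP ord0 i) => [j ->|->].
    have := Hy j; rewrite !tnth_behead.
    by rewrite !(tnth_nth 0%R) /= !inordK//= ltnS.
  by move: Hx; rewrite in_itv.
rewrite product_measure1E//; last exact: measurable_cube.
rewrite [X in X * _]lebesgue_measure_itv/= lte_fin ltrDl IH exprS.
case: ltP => [l1|l1]; first by rewrite -EFinB addrAC subrr add0r EFinM.
have -> : l = 0%R by apply/le_anti; rewrite l0 l1.
by rewrite mul0e mul0r.
Qed.

Context {n : nat}.
Hypothesis n_gt0 : (0 < n)%N.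
Implicit Types Q : set (euclid R n).

Lemma cube_sub_side (a b : euclid R n) (l m : R) : (0 < l)%R -> (0 <= m)%R ->
  cube a l `<=` cube b m -> (l <= m)%R.
Proof.
move=> l0 m0 ab; rewrite leNgt; apply/negP => ml.
pose i0 := Ordinal n_gt0.
have ha : cube a l a by move=> i; rewrite lexx ltrDl.
have hx : cube a l [tuple (tnth a i + m)%R | i < n].
  by move=> i; rewrite tnth_mktuple lerDl m0 ltrD2l.
have := ab _ hx i0; have := ab _ ha i0; rewrite tnth_mktuple.
by move=> /andP[ba _] /andP[_]; rewrite ltrD2r ltNge ba.
Qed.

End cube_facts.

Section dyadic_facts.
Context {R : realType} {n : nat}.
Hypothesis n_gt0 : (0 < n)%N.
Variable D : set (set (euclid R n)).
Hypothesis dyaD : dyadic_grid D.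
Implicit Types Q S : set (euclid R n).

Lemma dyadic_is_cube Q : D Q -> is_cube Q.
Proof.
by have [H _ _] := dyaD => /H[k sk]; exists (2 ^ k)%R => //; exact: exprz_gt0.
Qed.

Lemma cube_measurable Q : is_cube Q -> measurable Q.
Proof. by move=> [l l0 [a ->]]; exact: measurable_cube. Qed.

Lemma cube_volume_gt0 Q : is_cube Q -> 0 < volume Q.
Proof. by move=> [l l0 [a ->]]; rewrite volume_cube ?ltW// lte_fin exprn_gt0. Qed.

Lemma cube_volume_lty Q : is_cube Q -> volume Q < +oo.
Proof. by move=> [l l0 [a ->]]; rewrite volume_cube ?ltW// ltry. Qed.

Lemma cube_neq0 Q : is_cube Q -> Q !=set0.
Proof. by move=> [l l0 [a ->]]; exists a => i; rewrite lexx ltrDl. Qed.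

Lemma dyadic_nested Q Q' : D Q -> D Q' -> Q `&` Q' !=set0 ->
  Q `<=` Q' \/ Q' `<=` Q.
Proof.
have [_ H _] := dyaD => DQ DQ' [x QQx].
have [E|[E|E]] := H _ _ DQ DQ'; [left|right|].
- by rewrite -E => y [].
- by rewrite -E => y [].
- by rewrite E in QQx.
Qed.

Lemma dyadic_same_side Q Q' (k : int) : D Q -> D Q' ->
  has_side (2 ^ k)%R Q -> has_side (2 ^ k)%R Q' -> Q `<=` Q' -> Q = Q'.
Proof.
have [_ _ H] := dyaD => DQ DQ' kQ kQ' QQ'.
have [x Qx] := cube_neq0 (dyadic_is_cube DQ).
have [Q0 [_ uQ]] := H k x.
by rewrite -(uQ Q) ?(uQ Q')//; split => //; exact: QQ'.
Qed.

Lemma dyadic_sub_side Q Q' (k k' : int) :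
  has_side (2 ^ k)%R Q -> has_side (2 ^ k')%R Q' -> Q `<=` Q' -> (k <= k')%R.
Proof.
move=> [a ->] [b ->] /cube_sub_side - /(_ n_gt0).
rewrite exprz_gt0// exprz_ge0// => /(_ isT isT).
by rewrite ler_eXz2l ?ltr1n.
Qed.

Lemma child_exists (S : set (set (euclid R n))) Q Q' : S `<=` D -> S Q -> S Q' ->
  Q' `<` Q -> exists2 C, children S Q C & Q' `<=` C.
Proof.
move=> SD SQ SQ' Q'Q; have [sd _ _] := dyaD.
have [k kQ] := sd _ (SD _ SQ).
have [k' kQ'] := sd _ (SD _ SQ').
have [m] : exists m : nat, (k - k' <= m%:Z)%R.
  by exists `|k - k'|%N; rewrite abszE ler_norm.
elim: m Q' k' SQ' Q'Q kQ' => [|m IH] Q' k' SQ' Q'Q kQ' km.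
  have kk' : (k' <= k)%R by apply: dyadic_sub_side kQ' kQ _; case: Q'Q.
  have E : k' = k by apply/le_anti; rewrite kk' -subr_le0.
  case: Q'Q => QQ' []; rewrite E in kQ'.
  by rewrite (dyadic_same_side (SD _ SQ') (SD _ SQ) kQ' kQ QQ').
have [ch|] := pselect (children S Q Q'); first by exists Q'.
move=> nch.
have [Q2 [SQ2 Q2Q Q'Q2 neq]] :
    exists Q2, [/\ S Q2, Q2 `<` Q, Q' `<=` Q2 & Q2 <> Q'].
  apply: contrapT => no; apply: nch; split=> // Q2 SQ2 Q2Q Q'Q2.
  by apply: contrapT => ne; apply: no; exists Q2.
have [k2 kQ2] := sd _ (SD _ SQ2).
have k'k2 : (k' <= k2)%R by apply: dyadic_sub_side kQ' kQ2 _.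
have nk : k' != k2.
  apply/eqP => E; apply: neq; rewrite -E in kQ2.
  by rewrite (dyadic_same_side (SD _ SQ') (SD _ SQ2) kQ' kQ2 Q'Q2).
have [|C ch Q2C] := IH Q2 k2 SQ2 Q2Q kQ2; last by exists C => //; exact: subset_trans Q2C.
by move: km k'k2 nk; clear; lia.
Qed.

Lemma dyadic_countable : countable D.
Proof.
have [sd _ uD] := dyaD.
pose pt (t : n.-tuple rat) : euclid R n := [tuple ratr (tnth t i) | i < n].
have /choice[F FP] (kt : int * n.-tuple rat) : exists Q,
    [/\ D Q, has_side (2 ^ kt.1)%R Q & Q (pt kt.2)].
  by have [Q [HQ _]] := uD kt.1 (pt kt.2); exists Q.
apply: (@sub_countable _ _ D (range F)); last first.
  exact: (sub_countable (card_image_le _ _)).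
apply: subset_card_le => Q DQ; have [k kQ] := sd _ DQ.
have [a aE] := kQ.
have /choice[q qP] (i : 'I_n) : exists q : rat, (tnth a i <= ratr q < tnth a i + 2 ^ k)%R.
  have : (tnth a i < tnth a i + 2 ^ k)%R by rewrite ltrDl exprz_gt0.
  move=> /rat_in_itvoo[q]; rewrite in_itv/= => /andP[aq qb]; exists q.
  by rewrite ltW.
pose t := [tuple q i | i < n].
have Qt : Q (pt t) by rewrite aE => i; rewrite !tnth_mktuple.
exists (k, t) => //; have [DF kF Ft] := FP (k, t).
have [Q0 [_ uQ]] := uD k (pt t).
by rewrite -(uQ (F (k, t)))// -(uQ Q).
Qed.

End dyadic_facts.

Section finite_family.
Context {R : realType} {n : nat}.
Hypothesis n_gt0 : (0 < n)%N.
Variable D : set (set (euclid R n)).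
Hypothesis dyaD : dyadic_grid D.
Context {I : finType}.
Variable Q : I -> set (euclid R n).
Hypothesis DQ : forall i, D (Q i).
Hypothesis Qinj : injective Q.
Implicit Types (f g v w : euclid R n -> R) (i j : I).

Let cubeQ i : is_cube (Q i). Proof. exact: dyadic_is_cube (DQ i). Qed.

Let mQ i : measurable (Q i). Proof. exact: cube_measurable. Qed.

Let Q0 i : Q i !=set0. Proof. exact: cube_neq0. Qed.

Let nQ i j : Q i `&` Q j !=set0 -> Q i `<=` Q j \/ Q j `<=` Q i.
Proof. exact: dyadic_nested (DQ i) (DQ j). Qed.

Local Notation le := (subcube Q).
Local Notation core := (core Q).

Let mcore i : measurable (core i). Proof. exact: measurable_core. Qed.

Definition mass f i : R := fine (\int[volume]_(x in core i) (f x)%:E).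

Definition locfin f := [/\ measurable_fun setT f, forall x, (0 <= f x)%R
  & forall i, \int[volume]_(x in Q i) (f x)%:E < +oo].

Lemma locfin_integral_core f i : locfin f ->
  \int[volume]_(x in core i) (f x)%:E < +oo.
Proof.
move=> [mf f0 fQ]; apply: le_lt_trans (fQ i); apply: ge0_subset_integral => //.
- by apply/measurable_EFinP; exact: measurable_funTS.
- by move=> x _; rewrite lee_fin.
- exact: core_sub.
Qed.

Lemma massE f i : locfin f -> (mass f i)%:E = \int[volume]_(x in core i) (f x)%:E.
Proof.
move=> lf; rewrite /mass fineK// ge0_fin_numE ?locfin_integral_core//.
by case: lf => mf f0 _; apply: integral_ge0 => x _; rewrite lee_fin.
Qed.

Lemma mass_ge0 f i : locfin f -> (0 <= mass f i)%R.
Proof.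
move=> lf; rewrite -lee_fin massE//.
by case: lf => mf f0 _; apply: integral_ge0 => x _; rewrite lee_fin.
Qed.

Lemma down_massE f j : locfin f ->
  (down le (mass f) j)%:E = \int[volume]_(x in Q j) (f x)%:E.
Proof.
move=> lf; have [mf f0 fQ] := lf.
rewrite (integral_down volume mQ Q0 Qinj nQ); last 2 first.
- by apply/measurable_EFinP; exact: measurable_funTS.
- by move=> x; rewrite lee_fin.
by rewrite /down -sumEFin; apply: eq_bigr => i _; rewrite massE.
Qed.

Let integral_one (E : set (euclid R n)) : measurable E ->
  \int[volume]_(x in E) ((cst 1%R : euclid R n -> R) x)%:E = volume E.
Proof.
move=> mE; have := integral_cst (volume : {measure set (euclid R n) -> \bar R}) mE 1%:E.
by rewrite mul1e.
Qed.

Lemma locfin1 : locfin (cst 1%R).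
Proof.
by split=> // i; rewrite integral_one//; exact: cube_volume_lty.
Qed.

Definition vmass := mass (cst 1%R).

Lemma vmassE i : (vmass i)%:E = volume (core i).
Proof. by rewrite massE ?integral_one//; exact: locfin1. Qed.

Lemma down_vmassE i : (down le vmass i)%:E = volume (Q i).
Proof. by rewrite down_massE ?integral_one//; exact: locfin1. Qed.

Lemma down_vmass_gt0 i : (0 < down le vmass i)%R.
Proof. by rewrite -lte_fin down_vmassE; exact: cube_volume_gt0. Qed.

Lemma avgE f i : locfin f ->
  avg f (Q i) = (down le (mass f) i / down le vmass i)%:E.
Proof.
move=> lf; rewrite /avg -down_massE// -down_vmassE inver.
by rewrite gt_eqF ?down_vmass_gt0// -EFinM.
Qed.

Lemma mass_gt0 f i : locfin f -> (forall x, (0 < f x)%R) -> (0 < vmass i)%R ->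
  (0 < mass f i)%R.
Proof.
move=> lf f0 v0; rewrite -lte_fin massE//; apply: integral_gt0 => //.
- by have := v0; rewrite -lte_fin vmassE.
- by case: lf => mf _ _; exact: measurable_funTS.
Qed.

Lemma locfin_powRM f g (s t : R) : (0 < s)%R -> (0 < t)%R -> (s + t = 1)%R ->
  locfin f -> locfin g -> locfin (fun x => f x `^ s * g x `^ t)%R.
Proof.
move=> s0 t0 st [mf f0 fQ] [mg g0 gQ]; split=> [|x|i].
- by apply: measurable_funM; [exact: measurableT_comp (measurable_powR s) mf|
    exact: measurableT_comp (measurable_powR t) mg].
- by rewrite mulr_ge0 ?powR_ge0.
- apply: le_lt_trans (hoelder_set _ (mQ i) mf mg f0 g0 s0 t0 st) _.
  by rewrite lte_mul_pinfty ?poweR_ge0 ?fin_num_poweR ?poweR_lty// ge0_fin_numE//;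
     apply: integral_ge0 => x _; rewrite lee_fin.
Qed.

Lemma mass_hoelder f g (s t : R) i :
  (0 < s)%R -> (0 < t)%R -> (s + t = 1)%R -> locfin f -> locfin g ->
  (mass (fun x => f x `^ s * g x `^ t) i <= mass f i `^ s * mass g i `^ t)%R.
Proof.
move=> s0 t0 st lf lg; have lfg := locfin_powRM s0 t0 st lf lg.
rewrite -lee_fin (massE i lfg) EFinM -!poweR_EFin !massE//.
by move: lf lg => [mf f0 _] [mg g0 _]; exact: hoelder_set.
Qed.

Lemma vmass_sparse (S : set (set (euclid R n))) (d : R) j :
  S `<=` D -> sparse d S -> (forall i, S (Q i)) ->
  ((1 - d) * down le vmass j <= vmass j)%R.
Proof.
move=> SD sp SQ.
have /choice[ch chP] (i : I) : exists C, le i j -> i != j ->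
    children S (Q j) C /\ Q i `<=` C.
  have [/andP[/asboolP ij nij]|nij] := boolP (le i j && (i != j)).
    have Qij : Q i `<` Q j.
      by split=> // ji; move/eqP: nij; apply; apply: Qinj; exact/seteqP.
    have [C hC QC] := child_exists n_gt0 dyaD SD (SQ j) (SQ i) Qij.
    by exists C.
  by exists set0 => ij ne; rewrite ij ne in nij.
pose F := ch @` [set i | le i j && (i != j)].
have Ffin : finite_set F by apply: finite_image; exact: finite_finset.
have Fch : F `<=` children S (Q j).
  by move=> C [i /= /andP[ij ne] <-]; have [] := chP i ij ne.
have cF : volume (\bigcup_(C in F) C) <= d%:E * volume (Q j).
  have mF C : F C -> measurable C.
    by move=> /Fch[SC _ _]; apply: cube_measurable; exact: dyadic_is_cube (SD _ SC).
  apply: le_trans (sp _ (SQ j)).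
  apply: le_trans
    (@content_sub_fsum _ _ _ volume _ F (\bigcup_(C in F) C) id Ffin mF _ _) _ => //.
    exact: fin_bigcup_measurable.
  by apply: ereal_sup_ubound; exists F.
have QU : volume (Q j) <= volume (core j) + volume (\bigcup_(C in F) C).
  have mU : measurable (\bigcup_(C in F) C).
    apply: fin_bigcup_measurable => // C /Fch[SC _ _].
    by apply: cube_measurable; exact: dyadic_is_cube (SD _ SC).
  apply: le_trans (measureU2 _ (mcore j) mU).
  apply: le_measure; rewrite ?inE//; first exact: measurableU.
  move=> x Qx; have [i ij ci] := core_cover Q0 Qinj nQ Qx.
  have [E|ne] := eqVneq i j; [left; by rewrite -E|right].
  have [_ QC] := chP i ij ne; exists (ch i); last by apply: QC; exact: core_sub ci.
  by exists i => //=; rewrite ij.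
rewrite mulrBl mul1r lerBlDr -lee_fin EFinD EFinM vmassE down_vmassE.
by apply: le_trans QU _; rewrite leeD2l.
Qed.

End finite_family.

Lemma lee_poweR {R : realType} (x y : \bar R) (r : R) :
  (0 <= r)%R -> 0 <= x -> x <= y -> x `^ r <= y `^ r.
Proof.
move=> r0 x0 xy; apply: gt0_ler_poweR => //; rewrite in_itv/= ?x0 ?leey//.
by rewrite (le_trans x0 xy).
Qed.

Section maximal_carleson.
Context {R : realType} {n : nat}.
Hypothesis n_gt0 : (0 < n)%N.
Variable D : set (set (euclid R n)).
Hypothesis dyaD : dyadic_grid D.
Context {I : finType}.
Variable Q : I -> set (euclid R n).
Hypothesis DQ : forall i, D (Q i).
Hypothesis Qinj : injective Q.
Implicit Types (f g v w : euclid R n -> R) (i j : I).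

Let cubeQ i : is_cube (Q i). Proof. exact: dyadic_is_cube (DQ i). Qed.

Let mQ i : measurable (Q i). Proof. exact: cube_measurable. Qed.

Let Q0 i : Q i !=set0. Proof. exact: cube_neq0. Qed.

Let nQ i j : Q i `&` Q j !=set0 -> Q i `<=` Q j \/ Q j `<=` Q i.
Proof. exact: dyadic_nested (DQ i) (DQ j). Qed.

Local Notation le := (subcube Q).
Local Notation core := (core Q).

Let mcore i : measurable (core i). Proof. exact: measurable_core. Qed.

Let avg_ i v : R := (down le (mass Q v) i / down le (vmass Q) i)%R.

Lemma maximal_ge v i j x : locfin Q v -> le i j -> core i x ->
  (avg_ i v)%:E <= maximal (v \_ (Q j)) x.
Proof.
move=> lv /asboolP ij /core_sub ix; rewrite /avg_ -(avgE dyaD DQ Qinj)//.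
apply: ereal_sup_ubound; exists (Q i); first by split.
rewrite /avg; congr (_ / _); apply: eq_integral => y /[!inE] Qiy.
by case: lv => _ v0 _; rewrite patchE mem_set ?ger0_norm//; exact: ij.
Qed.

Lemma step_core (c : I -> R) i x : core i x ->
  (\sum_j c j * \1_(core j) x)%R = c i.
Proof.
move=> ix; rewrite (bigD1 i)//= big1 => [|j ji].
  by rewrite indicE mem_set// mulr1 addr0.
rewrite indicE memNset ?mulr0// => jx; move/eqP: ji; apply.
exact: core_disj jx ix.
Qed.

Lemma measurable_step (c : I -> R) (A : I -> set (euclid R n)) :
  (forall i, measurable (A i)) ->
  measurable_fun setT (fun x => \sum_j c j * \1_(A j) x)%R.
Proof.
by move=> mA; apply: measurable_sum => j; exact: measurable_funM.
Qed.

Lemma maximal_pair_carleson v1 v2 (s t W d : R) :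
  (0 < s)%R -> (0 < t)%R -> (s + t = 1)%R -> (0 <= W)%R -> (d < 1)%R ->
  locfin Q v1 -> locfin Q v2 ->
  (forall j, \int[volume]_(x in Q j)
     (maximal (v1 \_ (Q j)) x `^ s * maximal (v2 \_ (Q j)) x `^ t) <=
   W%:E * \int[volume]_(x in Q j) (v1 x `^ s * v2 x `^ t)%:E) ->
  (forall j, (1 - d) * down le (vmass Q) j <= vmass Q j)%R ->
  pair_carleson le (mass Q v1) (mass Q v2) s t (W / (1 - d)).
Proof.
move=> s0 t0 st W0 d1 l1 l2 H sp j.
have V0 i : (0 < down le (vmass Q) i)%R by exact: (down_vmass_gt0 dyaD DQ Qinj).
have avg0 i v : locfin Q v -> (0 <= avg_ i v)%R.
  move=> lv; rewrite divr_ge0 ?(ltW (V0 i))// down_ge0// => k.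
  exact: (mass_ge0 dyaD DQ).
pose c i := (avg_ i v1 `^ s * avg_ i v2 `^ t)%R.
have c0 i : (0 <= c i)%R by rewrite mulr_ge0 ?powR_ge0.
have E i : (down le (mass Q v1) i `^ s * down le (mass Q v2) i `^ t =
    c i * down le (vmass Q) i)%R.
  have split_ v : (down le (mass Q v) i = avg_ i v * down le (vmass Q) i)%R.
    by rewrite /avg_ divfK// gt_eqF.
  rewrite (split_ v1) (split_ v2) (powRM s (avg0 i v1 l1) (ltW (V0 i))).
  rewrite (powRM t (avg0 i v2 l2) (ltW (V0 i))) mulrACA -powRDx// st.
  by rewrite (powRr1 (ltW (V0 i))).
have step : (\sum_(i | le i j) c i * vmass Q i <=
    W * \sum_(i | le i j) mass Q v1 i `^ s * mass Q v2 i `^ t)%R.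
  have lv12 := locfin_powRM dyaD DQ s0 t0 st l1 l2.
  apply: (@le_trans _ _ (W * down le (mass Q (fun x => v1 x `^ s * v2 x `^ t)) j)%R).
    2: by apply: ler_wpM2l => //; apply: ler_sum => i _;
      exact: (mass_hoelder dyaD DQ).
  rewrite -lee_fin EFinM (down_massE dyaD DQ Qinj)//.
  apply: le_trans (H j).
  pose phi x := (\sum_i c i * \1_(core i) x)%R.
  have mphi : measurable_fun setT phi by exact: measurable_step.
  have phi0 x : (0 <= phi x)%R by apply: sumr_ge0 => i _; rewrite mulr_ge0.
  apply: (@le_trans _ _ (\int[volume]_(x in Q j) (phi x)%:E)).
    rewrite (integral_down volume mQ Q0 Qinj nQ); last 2 first.
    - by apply/measurable_EFinP; exact: measurable_funTS.
    - by move=> x; rewrite lee_fin.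
    rewrite -sumEFin; apply: lee_sum => i _.
    have -> : \int[volume]_(x in core i) (phi x)%:E =
        \int[volume]_(x in core i) (c i)%:E.
      by apply: eq_integral => x /[!inE] ix; rewrite /phi (step_core c ix).
    by rewrite integral_cst// EFinM (vmassE dyaD DQ).
  apply: ge0_le_integral_nonmeasurable => [x _|x Qjx]; first by rewrite lee_fin.
  have [i ij ix] := core_cover Q0 Qinj nQ Qjx.
  have m1 := maximal_ge l1 ij ix; have m2 := maximal_ge l2 ij ix.
  rewrite /phi (step_core c ix).
  have -> : (c i)%:E = (avg_ i v1)%:E `^ s * (avg_ i v2)%:E `^ t by [].
  apply: lee_pmul; [exact: poweR_ge0|exact: poweR_ge0| |].
    by apply: lee_poweR => //; [exact: ltW|rewrite lee_fin avg0].
  by apply: lee_poweR => //; [exact: ltW|rewrite lee_fin avg0].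
under eq_bigr do rewrite E.
have d10 : (0 < 1 - d)%R by rewrite subr_gt0.
rewrite mulrAC ler_pdivlMr// mulrC mulr_sumr; apply: le_trans step.
by apply: ler_sum => i _; rewrite mulrCA ler_wpM2l.
Qed.

End maximal_carleson.

Section family_estimate.
Context {R : realType} {n : nat}.
Hypothesis n_gt0 : (0 < n)%N.
Variable D : set (set (euclid R n)).
Hypothesis dyaD : dyadic_grid D.
Context {I : finType}.
Variable Q : I -> set (euclid R n).
Hypothesis DQ : forall i, D (Q i).
Hypothesis Qinj : injective Q.
Implicit Types (f g v w s y : euclid R n -> R) (i j : I).

Let cubeQ i : is_cube (Q i). Proof. exact: dyadic_is_cube (DQ i). Qed.

Let mQ i : measurable (Q i). Proof. exact: cube_measurable. Qed.

Let Q0 i : Q i !=set0. Proof. exact: cube_neq0. Qed.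

Let nQ i j : Q i `&` Q j !=set0 -> Q i `<=` Q j \/ Q j `<=` Q i.
Proof. exact: dyadic_nested (DQ i) (DQ j). Qed.

Local Notation le := (subcube Q).
Local Notation core := (core Q).

Let mcore i : measurable (core i). Proof. exact: measurable_core. Qed.

Lemma sum_indic_core (b : I -> R) i x : core i x ->
  (\sum_j b j * \1_(Q j) x = \sum_(j | le i j) b j)%R.
Proof.
move=> ix; rewrite [RHS]big_mkcond; apply: eq_bigr => j _; rewrite indicE.
have [_ H] := (coreP Q i x).1 ix.
case: ifPn => [/asboolP ij|nij].
  by rewrite mem_set ?mulr1//; apply: ij; exact: core_sub ix.
by rewrite memNset ?mulr0// => /H; rewrite (negbTE nij).
Qed.

Lemma step_integral (b : I -> R) (r : R) w : (0 < r)%R -> (forall i, (0 <= b i)%R) ->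
  locfin Q w ->
  \int[volume]_x (((\sum_i b i * \1_(Q i) x) `^ r)%R * w x)%:E =
  (\sum_i mass Q w i * (\sum_(j | le i j) b j) `^ r)%:E.
Proof.
move=> r0 b0 lw; have [mw w0 _] := lw.
pose h x := (((\sum_i b i * \1_(Q i) x) `^ r)%R * w x)%R.
have mh : measurable_fun setT h.
  apply: measurable_funM => //.
  by apply: (measurableT_comp (measurable_powR r)); exact: measurable_step.
rewrite (integral_cores volume mQ Q0 Qinj nQ); first last.
- move=> x nx; rewrite big1 => [|i _].
    by rewrite powR0 ?gt_eqF// mul0r.
  by rewrite indicE memNset// mulr0.
- by move=> x; rewrite lee_fin mulr_ge0 ?powR_ge0.
- exact/measurable_EFinP.
rewrite -sumEFin; apply: eq_bigr => i _; rewrite mulrC EFinM (massE dyaD DQ)//.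
pose c := ((\sum_(j | le i j) b j) `^ r)%R.
transitivity (\int[volume]_(x in core i) (c%:E * (w x)%:E)).
  by apply: eq_integral => x /[!inE] ix; rewrite (sum_indic_core b ix).
apply: ge0_integralZl => //.
- by apply/measurable_EFinP; exact: measurable_funTS.
- by move=> x _; rewrite lee_fin.
- by rewrite lee_fin powR_ge0.
Qed.

Lemma pavg_massE (r : R) f s i : (0 < r)%R -> (forall x, (0 < s x)%R) ->
  locfin Q (fun x => `|f x| `^ r * s x)%R ->
  pavg r (fun x => f x * s x `^ r^-1)%R (Q i) =
  ((down le (mass Q (fun x => `|f x| `^ r * s x)%R) i / down le (vmass Q) i)
    `^ r^-1)%:E.
Proof.
move=> r0 s0 lf; rewrite /pavg (_ : (fun x => _) = (fun x => `|f x| `^ r * s x)%R).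
  by rewrite (avgE dyaD DQ Qinj)// poweR_EFin.
apply/funext => x; rewrite normrM (ger0_norm (powR_ge0 _ _)) powRM ?powR_ge0//.
by rewrite -(powRrM (s x)) mulVf ?gt_eqF// powRr1 ?ltW.
Qed.

Lemma powR_interpolation (u v r q t : R) : (0 <= u)%R -> (0 < v)%R -> (q * t = r)%R ->
  ((u `^ q * v) `^ t * v `^ (1 - t) = u `^ r * v)%R.
Proof.
move=> u0 v0 qt; rewrite (powRM _ (powR_ge0 _ _) (ltW v0)) -(powRrM u) qt.
by rewrite -mulrA -powRDx// addrC subrK powRr1 ?ltW.
Qed.

Lemma locfin_Lp (q : R) f s : measurable_fun setT s -> (forall x, (0 < s x)%R) ->
  measurable_fun setT f -> \int[volume]_x (`|f x| `^ q * s x)%:E < +oo ->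
  locfin Q (fun x => `|f x| `^ q * s x)%R.
Proof.
move=> ms s0 mf foo.
have mfs : measurable_fun setT (fun x => `|f x| `^ q * s x)%R.
  apply: measurable_funM => //; apply: (measurableT_comp (measurable_powR q)).
  exact: measurableT_comp.
split=> // [x|i]; first by rewrite mulr_ge0 ?powR_ge0 ?ltW.
apply: le_lt_trans foo; apply: ge0_subset_integral => //.
- exact/measurable_EFinP.
- by move=> x _; rewrite lee_fin mulr_ge0 ?powR_ge0 ?ltW.
Qed.

Lemma sum_mass_le f : locfin Q f ->
  (\sum_i mass Q f i)%:E <= \int[volume]_x (f x)%:E.
Proof.
move=> lf; have [mf f0 _] := lf; rewrite -sumEFin.
under eq_bigr do rewrite (massE dyaD DQ)//.
apply: (sum_integral_cores_le volume mQ Q0 Qinj nQ).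
- exact/measurable_EFinP.
- by move=> x; rewrite lee_fin.
Qed.

End family_estimate.

Section finite_estimate.
Context {R : realType} {n : nat}.
Hypothesis n_gt0 : (0 < n)%N.
Implicit Types (f v w s : euclid R n -> R).

Definition positive_weight w := [/\ measurable_fun setT w,
  forall x, (0 < w x)%R
  & forall Q, is_cube Q -> \int[volume]_(x in Q) (w x)%:E < +oo].

Lemma lee_pmul3 (K u v : R) (a b : \bar R) :
  (0 <= K)%R -> (0 <= u)%R -> (0 <= v)%R -> u%:E <= a -> v%:E <= b ->
  (K * u * v)%:E <= K%:E * a * b.
Proof.
move=> K0 u0 v0 ua vb; rewrite !EFinM; apply: lee_pmul => //.
- by rewrite -EFinM lee_fin mulr_ge0.
- by apply: lee_pmul.
Qed.

Lemma W_const_le (a b W : R) v1 v2 Q :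
  (0 < a)%R -> (0 < b)%R -> (a + b = 1)%R ->
  positive_weight v1 -> positive_weight v2 -> is_cube Q ->
  W_const a b v1 v2 <= W%:E ->
  \int[volume]_(x in Q) (maximal (v1 \_ Q) x `^ a * maximal (v2 \_ Q) x `^ b) <=
  W%:E * \int[volume]_(x in Q) (v1 x `^ a * v2 x `^ b)%:E.
Proof.
move=> a0 b0 ab [m1 p1 i1] [m2 p2 i2] cQ HW.
set den := \int[volume]_(x in Q) (v1 x `^ a * v2 x `^ b)%:E.
set num := \int[volume]_(x in Q) _.
have mQ := cube_measurable cQ.
have le1 : num / den <= W%:E.
  by apply: le_trans HW; apply: ereal_sup_ubound; exists Q.
have m12 : measurable_fun setT (fun x => v1 x `^ a * v2 x `^ b)%R.
  by apply: measurable_funM; [exact: measurableT_comp (measurable_powR a) m1|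
    exact: measurableT_comp (measurable_powR b) m2].
have den0 : 0 < den.
  apply: integral_gt0 => //.
  - exact: cube_volume_gt0.
  - exact: measurable_funTS.
  - by move=> x _; rewrite mulr_gt0 ?powR_gt0.
have deny : den < +oo.
  apply: le_lt_trans (hoelder_set volume mQ m1 m2 (fun x => ltW (p1 x))
    (fun x => ltW (p2 x)) a0 b0 ab) _.
  rewrite lte_mul_pinfty ?poweR_ge0 ?fin_num_poweR ?poweR_lty ?i1 ?i2//.
  by rewrite ge0_fin_numE ?i1//; apply: integral_ge0 => x _; rewrite lee_fin ltW.
have denE : den = (fine den)%:E by rewrite fineK// ge0_fin_numE// ltW.
have fd0 : (0 < fine den)%R by rewrite fine_gt0// den0.
by move: le1; rewrite {1}denE inver gt_eqF// lee_pdivrMr// -denE.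
Qed.

Lemma positive_weight_locfin (I : finType) (Q : I -> set (euclid R n)) w :
  (forall i, is_cube (Q i)) -> positive_weight w -> locfin Q w.
Proof. by move=> cQ [mw w0 iw]; split=> // [x|i]; [exact: ltW|exact: iw]. Qed.

Lemma finite_estimate (gamma p0 p1 p2 p delta : R) :
  (0 < gamma)%R -> (1 <= p0)%R -> (p0 < p1)%R -> (p0 < p2)%R ->
  (p^-1 = p1^-1 + p2^-1)%R -> (0 < delta)%R -> (delta < 1)%R ->
  exists2 C : R, (0 < C)%R &
  forall (D S : set (set (euclid R n))),
  dyadic_grid D -> S `<=` D -> sparse delta S ->
  forall w s1 s2, positive_weight w -> positive_weight s1 -> positive_weight s2 ->
  forall A W12 W1 W2 : R, (0 < A)%R -> (0 <= W12)%R -> (0 <= W1)%R -> (0 <= W2)%R ->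
  A_const p0 p1 p2 p w s1 s2 <= A%:E -> W_infty p1 p2 p s1 s2 <= W12%:E ->
  W_infty_partial gamma p1 p2 p w s2 <= W1%:E ->
  W_infty_partial gamma p2 p1 p w s1 <= W2%:E ->
  forall f1 f2, in_Lp p1 s1 f1 -> in_Lp p2 s2 f2 ->
  forall (I : finType) (Q : I -> set (euclid R n)), injective Q ->
  (forall i, S (Q i)) ->
  (\int[volume]_x ((\sum_i
      ((pavg p0 (fun x => f1 x * s1 x `^ p0^-1)%R (Q i)
        * pavg p0 (fun x => f2 x * s2 x `^ p0^-1)%R (Q i)) `^ gamma
       * (\1_(Q i) x)%:E)) `^ (p / gamma) * (w x)%:E)) `^ p^-1 <=
  (C * A `^ p^-1 * (W12 `^ p^-1 +
    (W1 `^ (gamma * conj_exp (p1 / gamma))^-1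
     + W2 `^ (gamma * conj_exp (p2 / gamma))^-1)))%:E
  * wnorm p1 s1 (EFin \o f1) * wnorm p2 s2 (EFin \o f2).
Proof.
move=> g0 p01 p01lt p02lt pE d0 d1.
have [C C0 HC] := discrete_estimate g0 p01 p01lt p02lt pE d0 d1.
have p00 : (0 < p0)%R by exact: lt_le_trans p01.
have p10 : (0 < p1)%R by exact: lt_trans p01lt.
have p20 : (0 < p2)%R by exact: lt_trans p02lt.
have p_gt0 : (0 < p)%R by rewrite -invr_gt0 pE addr_gt0// invr_gt0.
exists C => // D S dyaD SD sp w s1 s2 pw ps1 ps2 A W12 W1 W2 A0 W120 W10 W20.
move=> HA H12 H1 H2 f1 f2 [mf1 f1fin] [mf2 f2fin] I Q Qinj SQ.
have DQ i : D (Q i) by exact/SD/SQ.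
have cQ i : is_cube (Q i) by exact: dyadic_is_cube (DQ i).
pose le := subcube Q.
have leF : forest le.
  apply: subcube_forest => // [i|i j]; first exact: cube_neq0.
  exact: dyadic_nested (DQ i) (DQ j).
have lw := positive_weight_locfin cQ pw.
have l1 := positive_weight_locfin cQ ps1.
have l2 := positive_weight_locfin cQ ps2.
have [mw w0 _] := pw; have [ms1 s10 _] := ps1; have [ms2 s20 _] := ps2.
pose x1 := fun x => (`|f1 x| `^ p0 * s1 x)%R.
pose x2 := fun x => (`|f2 x| `^ p0 * s2 x)%R.
pose y1 := fun x => (`|f1 x| `^ p1 * s1 x)%R.
pose y2 := fun x => (`|f2 x| `^ p2 * s2 x)%R.
have r0 : (0 < p / gamma)%R by exact: divr_gt0.
have t1a : (gamma / p1 / (gamma / p0) = p0 / p1)%R by field; rewrite !gt_eqF.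
have t2a : (gamma / p2 / (gamma / p0) = p0 / p2)%R by field; rewrite !gt_eqF.
have wn1 : wnorm p1 s1 (EFin \o f1) = (\int[volume]_x (y1 x)%:E) `^ p1^-1 by [].
have wn2 : wnorm p2 s2 (EFin \o f2) = (\int[volume]_x (y2 x)%:E) `^ p2^-1 by [].
have Y1y : \int[volume]_x (y1 x)%:E < +oo.
  by apply: lty_poweRy f1fin; rewrite invr_eq0 gt_eqF.
have Y2y : \int[volume]_x (y2 x)%:E < +oo.
  by apply: lty_poweRy f2fin; rewrite invr_eq0 gt_eqF.
have ly1 : locfin Q y1 by exact: (locfin_Lp dyaD DQ ms1 s10 mf1 Y1y).
have ly2 : locfin Q y2 by exact: (locfin_Lp dyaD DQ ms2 s20 mf2 Y2y).
have q01 : (0 < p0 / p1)%R by exact: divr_gt0.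
have q02 : (0 < p0 / p2)%R by exact: divr_gt0.
have q11 : (0 < 1 - p0 / p1)%R by rewrite subr_gt0 ltr_pdivrMr// mul1r.
have q12 : (0 < 1 - p0 / p2)%R by rewrite subr_gt0 ltr_pdivrMr// mul1r.
have x1E : x1 = (fun x => y1 x `^ (p0 / p1) * s1 x `^ (1 - p0 / p1))%R.
  apply/funext => x; rewrite /x1 /y1 (@powR_interpolation _ _ _ p0)//.
  by rewrite mulrC divfK// gt_eqF.
have x2E : x2 = (fun x => y2 x `^ (p0 / p2) * s2 x `^ (1 - p0 / p2))%R.
  apply/funext => x; rewrite /x2 /y2 (@powR_interpolation _ _ _ p0)//.
  by rewrite mulrC divfK// gt_eqF.
have addK (q : R) : (q + (1 - q) = 1)%R by rewrite addrC subrK.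
have lx1 : locfin Q x1.
  by rewrite x1E; exact: (locfin_powRM dyaD DQ q01 q11 (addK _) ly1 l1).
have lx2 : locfin Q x2.
  by rewrite x2E; exact: (locfin_powRM dyaD DQ q02 q12 (addK _) ly2 l2).
have spQ j : ((1 - delta) * down le (vmass Q) j <= vmass Q j)%R.
  exact: (vmass_sparse n_gt0 dyaD DQ Qinj j SD sp SQ).
have v0 i : (0 < vmass Q i)%R.
  apply: lt_le_trans (spQ i); rewrite mulr_gt0 ?subr_gt0//.
  exact: (down_vmass_gt0 dyaD DQ Qinj).
have gap (q : R) : (p0 < q)%R ->
    ((gamma / p0 - gamma / q) / (gamma / p1 + gamma / p2) = p / p0 / conj_exp (q / p0))%R.
  move=> p0q; have q0 : (0 < q)%R by exact: lt_trans p0q.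
  rewrite conj_expE; last by rewrite ltr_pdivlMr// mul1r.
  rewrite -mulrDr -pE; field.
  by rewrite ?mulN1r !gt_eqF// subr_gt0.
have model : sparse_model le delta (gamma / p0) (gamma / p1) (gamma / p2) A
    (mass Q s1) (mass Q s2) (mass Q w) (vmass Q) (mass Q x1) (mass Q x2)
    (mass Q y1) (mass Q y2).
  split=> //; try by move=> i; exact: (mass_gt0 dyaD DQ).
  - by move=> i; exact: (mass_ge0 dyaD DQ).
  - by move=> i; exact: (mass_ge0 dyaD DQ).
  - by move=> i; exact: (mass_ge0 dyaD DQ).
  - by move=> i; exact: (mass_ge0 dyaD DQ).
  - by move=> i; rewrite t1a x1E; exact: (mass_hoelder dyaD DQ).
  - by move=> i; rewrite t2a x2E; exact: (mass_hoelder dyaD DQ).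
  - move=> i; rewrite (gap p1)// (gap p2)// -lee_fin; apply: le_trans HA.
    apply: ereal_sup_ubound; exists (Q i) => //.
    by rewrite !(avgE dyaD DQ Qinj).
have pair12 : pair_carleson le (mass Q s1) (mass Q s2) (p / p1) (p / p2)
    (W12 / (1 - delta)).
  have pp1 : (0 < p / p1)%R by exact: divr_gt0.
  have pp2 : (0 < p / p2)%R by exact: divr_gt0.
  have pp : (p / p1 + p / p2 = 1)%R by rewrite -mulrDr -pE divff// gt_eqF.
  apply: (maximal_pair_carleson dyaD DQ Qinj pp1 pp2 pp W120 d1 l1 l2) => // j.
  exact: W_const_le.
have partial (ri rj W : R) v s : (p^-1 = ri^-1 + rj^-1)%R -> (0 < ri)%R -> (0 < rj)%R ->
    positive_weight v -> positive_weight s -> (0 <= W)%R -> (gamma < p)%R ->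
    W_infty_partial gamma ri rj p v s <= W%:E ->
    pair_carleson le (mass Q v) (mass Q s) (conj_exp (ri / gamma) / conj_exp (p / gamma))
      (conj_exp (ri / gamma) / (rj / gamma)) (W / (1 - delta)).
  move=> prr ri0 rj0 pv ps W0 gp; rewrite /W_infty_partial (lt_geF gp) => HW.
  have pri : (p < ri)%R by rewrite -ltf_pV2// prr ltrDl invr_gt0.
  have gri : (gamma < ri)%R by exact: lt_trans pri.
  have ci : conj_exp (ri / gamma) = (ri / (ri - gamma))%R.
    rewrite conj_expE; last by rewrite ltr_pdivlMr// mul1r.
    by field; rewrite ?mulN1r !gt_eqF// subr_gt0.
  have cp : conj_exp (p / gamma) = (p / (p - gamma))%R.
    rewrite conj_expE; last by rewrite ltr_pdivlMr// mul1r.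
    by field; rewrite ?mulN1r !gt_eqF// subr_gt0.
  have ci0 : (0 < conj_exp (ri / gamma))%R by rewrite ci divr_gt0// subr_gt0.
  have cp0 : (0 < conj_exp (p / gamma))%R by rewrite cp divr_gt0// subr_gt0.
  have e1 : (0 < conj_exp (ri / gamma) / conj_exp (p / gamma))%R by exact: divr_gt0.
  have e2 : (0 < conj_exp (ri / gamma) / (rj / gamma))%R by rewrite !divr_gt0.
  have e12 : (conj_exp (ri / gamma) / conj_exp (p / gamma)
      + conj_exp (ri / gamma) / (rj / gamma) = 1)%R.
    have rjE : (rj^-1 = p^-1 - ri^-1)%R by rewrite prr addrAC subrr add0r.
    rewrite invf_div rjE ci cp; field.
    by rewrite ?mulN1r !gt_eqF// subr_gt0.
  have lv := positive_weight_locfin cQ pv; have ls := positive_weight_locfin cQ ps.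
  apply: (maximal_pair_carleson dyaD DQ Qinj e1 e2 e12 W0 d1 lv ls) => // j.
  exact: W_const_le.
have pEC : (p^-1 = p2^-1 + p1^-1)%R by rewrite pE addrC.
have real_le := HC I le A _ _ _ _ _ _ _ _ W12 W1 W2 A0 W120 W10 W20 model pair12
  (fun gp => partial p1 p2 W1 w s2 pE p10 p20 pw ps2 W10 gp H1)
  (fun gp => partial p2 p1 W2 w s1 pEC p20 p10 pw ps1 W20 gp H2).
pose b := coef le (gamma / p0) (vmass Q) (mass Q x1) (mass Q x2).
have b0 i : (0 <= b i)%R by rewrite mulr_ge0 ?powR_ge0.
have cE (u v : R) :
    (u `^ (gamma / p0) * v `^ (gamma / p0) = (u `^ p0^-1 * v `^ p0^-1) `^ gamma)%R.
  by rewrite powRM ?powR_ge0// -(powRrM u) -(powRrM v) (mulrC p0^-1%R).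
have sumE x : \sum_i ((pavg p0 (fun x => f1 x * s1 x `^ p0^-1)%R (Q i)
        * pavg p0 (fun x => f2 x * s2 x `^ p0^-1)%R (Q i)) `^ gamma
       * (\1_(Q i) x)%:E) = (\sum_i b i * \1_(Q i) x)%:E.
  rewrite -sumEFin; apply: eq_bigr => i _.
  rewrite (pavg_massE dyaD DQ Qinj i p00 s10 lx1).
  rewrite (pavg_massE dyaD DQ Qinj i p00 s20 lx2).
  rewrite EFinM; congr (_ * _).
  have -> : b i = (((down le (mass Q x1) i / down le (vmass Q) i) `^ p0^-1
      * (down le (mass Q x2) i / down le (vmass Q) i) `^ p0^-1) `^ gamma)%R.
    exact: cE.
  by [].
under eq_integral do rewrite sumE poweR_EFin -EFinM.
rewrite (step_integral dyaD DQ Qinj r0 b0 lw) poweR_EFin.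
have S1 := sum_mass_le dyaD DQ Qinj ly1; have S2 := sum_mass_le dyaD DQ Qinj ly2.
have sum0 y : locfin Q y -> 0 <= (\sum_i mass Q y i)%:E.
  by move=> ly; rewrite lee_fin sumr_ge0// => i _; exact: (mass_ge0 dyaD DQ).
have M1 : ((\sum_i mass Q y1 i) `^ p1^-1)%:E <= wnorm p1 s1 (EFin \o f1).
  by rewrite wn1 -poweR_EFin lee_poweR ?invr_ge0 ?(ltW p10) ?sum0.
have M2 : ((\sum_i mass Q y2 i) `^ p2^-1)%:E <= wnorm p2 s2 (EFin \o f2).
  by rewrite wn2 -poweR_EFin lee_poweR ?invr_ge0 ?(ltW p20) ?sum0.
have K0 : (0 <= C * A `^ p^-1 * (W12 `^ p^-1 +
    (W1 `^ (gamma * conj_exp (p1 / gamma))^-1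
     + W2 `^ (gamma * conj_exp (p2 / gamma))^-1)))%R.
  apply: mulr_ge0; first by rewrite mulr_ge0 ?powR_ge0// ltW.
  by rewrite !addr_ge0 ?powR_ge0.
have := lee_pmul3 K0 (powR_ge0 _ _) (powR_ge0 _ _) M1 M2.
by apply: le_trans; rewrite lee_fin.
Qed.

End finite_estimate.

(** * Countable families and almost everywhere positive weights *)

Section countable_sum.
Context d (T : measurableType d) (R : realType).
Variable mu : {measure set T -> \bar R}.

Lemma integral_esum_powR_le (S : set (set T)) (b : set T -> \bar R)
    (w : T -> R) (r : R) (B : \bar R) :
  countable S -> (forall Q, S Q -> measurable Q) -> (forall Q, 0 <= b Q) ->
  (0 < r)%R -> measurable_fun setT w -> (forall x, (0 < w x)%R) ->
  (forall (I : finType) (Q : I -> set T), injective Q -> (forall i, S (Q i)) ->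
    \int[mu]_x ((\sum_i b (Q i) * (\1_(Q i) x)%:E) `^ r * (w x)%:E) <= B) ->
  \int[mu]_x ((\esum_(Q in S) (b Q * (\1_Q x)%:E)) `^ r * (w x)%:E) <= B.
Proof.
move=> /countable_injP[phi phi_inj] mS b0 r0 mw w0 HB.
pose SN N := [set Q | S Q /\ (phi Q < N)%N].
have SNS N : SN N `<=` S by move=> Q [].
have SNfin N : finite_set (SN N).
  have phiN : {in SN N &, injective phi}.
    by move=> Q Q' /set_mem[SQ _] /set_mem[SQ' _]; apply: phi_inj; exact: mem_set.
  rewrite -(eq_finite_set (inj_card_eq phiN)).
  by apply: sub_finite_set (finite_II N) => _ [Q [_ QN] <-].
have a0 x Q : 0 <= b Q * (\1_Q x)%:E by rewrite mule_ge0// lee_fin.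
pose s N x := \sum_(Q <- fset_set (SN N)) (b Q * (\1_Q x)%:E).
have s0 N x : 0 <= s N x by apply: sume_ge0.
have sE N x : s N x = \esum_(Q in SN N) (b Q * (\1_Q x)%:E).
  by rewrite esum_fset// fsbig_finite.
have s_nd x N M : (N <= M)%N -> s N x <= s M x.
  move=> NM; rewrite !sE; apply: ge_ereal_sup => _ [A [Afin ASN] <-].
  apply: esum_ge; exists A => //; split=> // Q /ASN[SQ QN]; split=> //.
  exact: leq_trans NM.
pose g N x := s N x `^ r * (w x)%:E.
have w0' x : 0 <= (w x)%:E by rewrite lee_fin ltW.
have g0 N x : 0 <= g N x by rewrite mule_ge0 ?poweR_ge0.
have g_nd x : nondecreasing_seq (g ^~ x).
  move=> N M NM; apply: lee_wpmul2r => //.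
  by apply: lee_poweR => //; [exact: ltW|exact: s_nd].
have mg N : measurable_fun setT (g N).
  apply: emeasurable_funM; last exact/measurable_EFinP.
  apply: (measurableT_comp (measurable_poweR r)).
  rewrite /s; under eq_fun do rewrite big_seq_fsetE/=.
  apply: emeasurable_sum => i; apply: emeasurable_funM => //.
  apply/measurable_EFinP/measurable_indic/mS/(SNS N).
  by have := valP i; rewrite in_fset_set// => /set_mem.
have gB N : \int[mu]_x g N x <= B.
  rewrite /g /s; under eq_integral do rewrite big_seq_fsetE/=.
  apply: (HB (fset_set (SN N)) val); first exact: val_inj.
  by move=> i; apply/(SNS N); have := valP i; rewrite in_fset_set// => /set_mem.
apply: (@le_trans _ _ (\int[mu]_x limn (g ^~ x))).
  apply: ge0_le_integral_nonmeasurable => x _.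
    by rewrite mule_ge0 ?poweR_ge0.
  have gL N : g N x <= limn (g ^~ x).
    have -> : limn (g ^~ x) = ereal_sup (range (g ^~ x)).
      by apply/cvg_lim => //; exact: ereal_nondecreasing_cvgn.
    by apply: ereal_sup_ubound; exists N.
  move: gL; case: (limn (g ^~ x)) => [l| |] gL; last 2 first.
  - by rewrite leey.
  - by have := gL 0%N; rewrite leeNy_eq => /eqP g0N; have := g0 0%N x; rewrite g0N.
  rewrite -lee_pdivlMr//.
  have lw0 : (0 <= l / w x)%R.
    by rewrite divr_ge0 ?(ltW (w0 x))// -lee_fin; apply: le_trans (gL 0%N).
  have sl N : s N x <= ((l / w x) `^ r^-1)%:E.
    have sr : s N x `^ r <= (l / w x)%:E by rewrite EFinM lee_pdivlMr//; exact: gL.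
    have ri0 : (0 <= r^-1)%R by rewrite invr_ge0 ltW.
    have := lee_poweR ri0 (poweR_ge0 _ _) sr.
    by rewrite -poweRrM divff ?gt_eqF// poweRe1.
  have Sl : \esum_(Q in S) (b Q * (\1_Q x)%:E) <= ((l / w x) `^ r^-1)%:E.
    apply: ge_ereal_sup => _ [A [Afin AS] <-].
    pose N := (\max_(Q <- fset_set A) phi Q).+1.
    apply: le_trans (sl N); rewrite sE; apply: esum_ge; exists A => //.
    split=> // Q AQ; split; first exact: AS.
    by rewrite ltnS; apply: leq_bigmax_seq => //; rewrite in_fset_set//; exact: mem_set.
  have := lee_poweR (ltW r0) (esum_ge0 (fun Q _ => a0 x Q)) Sl.
  by rewrite poweR_EFin -powRrM mulVf ?gt_eqF// powRr1// EFinM.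
rewrite monotone_convergence//; apply: lime_le; last exact: nearW.
apply: ereal_nondecreasing_is_cvgn => N M NM; apply: ge0_le_integral => //.
by move=> x _; exact: g_nd.
Qed.

End countable_sum.

Section nonmeasurable.
Context d (T : measurableType d) (R : realType).
Variable mu : {measure set T -> \bar R}.

Lemma measurable_patch (u : T -> R) D : measurable D ->
  measurable_fun setT u -> measurable_fun setT (u \_ D).
Proof.
by move=> mD mu'; apply/(measurable_restrictT _ mD).1; exact: measurable_funTS.
Qed.

Lemma ae_ge0_le_integral (f g : T -> \bar R) : (forall x, f x <= g x) ->
  (forall x, 0 <= g x) -> {ae mu, forall x, 0 <= f x} ->
  0 <= \int[mu]_x f x <= \int[mu]_x g x.
Proof.
move=> fg g0 [N [mN N0 fN]]; rewrite integralE.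
have -> : \int[mu]_x f^\- x = 0.
  apply/le_anti/andP; split; last by apply: integral_ge0 => x _; exact: funeneg_ge0.
  apply: (@le_trans _ _ (\int[mu]_(x in N) (cst +oo) x)).
    rewrite [leRHS]integral_mkcond; apply: ge0_le_integral_nonmeasurable => x _.
      exact: funeneg_ge0.
    rewrite patchE; case: ifPn => [_|xN]; first by rewrite leey.
    have fx0 : 0 <= f x.
      by apply: contrapT => fx; move/negP: xN; apply; apply: mem_set; exact: fN.
    by rewrite funenegE ge_max lexx andbT oppe_le0.
  by rewrite integral_cst// N0 mule0.
rewrite sube0 integral_ge0/=; last by move=> x _; exact: funepos_ge0.
apply: ge0_le_integral_nonmeasurable => x _; first exact: funepos_ge0.
by rewrite funeposE ge_max fg g0.
Qed.

End nonmeasurable.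

Section ae_invariance.
Context {R : realType} {n : nat}.
Implicit Types (f v w : euclid R n -> R) (Q : set (euclid R n)).

Definition ae_same v w := [/\ measurable_fun setT v, measurable_fun setT w
  & {ae volume, forall x, v x = w x}].

Lemma integral_ae_same v w Q : measurable Q -> ae_same v w ->
  \int[volume]_(x in Q) (v x)%:E = \int[volume]_(x in Q) (w x)%:E.
Proof.
move=> mQ [mv mw vw]; apply: ae_eq_integral => //.
- by apply/measurable_EFinP; exact: measurable_funTS.
- by apply/measurable_EFinP; exact: measurable_funTS.
- by apply: filterS vw => x vwx _; rewrite vwx.
Qed.

Lemma ae_same_comp v w (h : euclid R n -> R -> R) : ae_same v w ->
  (forall u, measurable_fun setT u -> measurable_fun setT (fun x => h x (u x))) ->
  ae_same (fun x => h x (v x)) (fun x => h x (w x)).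
Proof.
move=> [mv mw vw] mh; split; [exact: mh|exact: mh|].
by apply: filterS vw => x ->.
Qed.

Lemma ae_sameM v w v' w' : ae_same v w -> ae_same v' w' ->
  ae_same (fun x => v x * v' x)%R (fun x => w x * w' x)%R.
Proof.
move=> [mv mw vw] [mv' mw' vw']; split; [exact: measurable_funM..|].
by apply: filterS2 vw vw' => x -> ->.
Qed.

Lemma ae_same_powR v w (r : R) : ae_same v w ->
  ae_same (fun x => v x `^ r)%R (fun x => w x `^ r)%R.
Proof.
move=> /(@ae_same_comp _ _ (fun _ y => y `^ r)%R); apply => u mu.
exact: measurableT_comp (measurable_powR r) mu.
Qed.

Lemma ae_same_refl f : measurable_fun setT f -> ae_same f f.
Proof. by move=> mf; split=> //; exact: aeW. Qed.

Lemma ae_same_norm v w : ae_same v w ->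
  ae_same (fun x => `|v x|)%R (fun x => `|w x|)%R.
Proof.
move=> /(@ae_same_comp _ _ (fun _ y => `|y|)%R); apply => u mu.
exact: measurableT_comp.
Qed.

Lemma avg_ae v w Q : is_cube Q -> ae_same v w -> avg v Q = avg w Q.
Proof.
by move=> cQ vw; rewrite /avg (integral_ae_same _ vw)//; exact: cube_measurable.
Qed.

Lemma pavg_ae (r : R) v w Q : is_cube Q -> ae_same v w -> pavg r v Q = pavg r w Q.
Proof.
by move=> cQ vw; rewrite /pavg (avg_ae cQ (ae_same_powR r (ae_same_norm vw))).
Qed.

Lemma maximal_ae v w Q : is_cube Q -> ae_same v w ->
  maximal (v \_ Q) = maximal (w \_ Q).
Proof.
move=> cQ vw; apply/funext => x; rewrite /maximal; apply: congr1.
apply: eq_imagel => P [cP _].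
apply: avg_ae => //; apply: ae_same_norm; have [mv mw vwx] := vw.
have mQ := cube_measurable cQ.
split; [exact: measurable_patch..|].
by apply: filterS vwx => y vwy; rewrite !patchE vwy.
Qed.

Lemma W_const_ae (a b : R) v1 v2 w1 w2 : ae_same v1 w1 -> ae_same v2 w2 ->
  W_const a b v1 v2 = W_const a b w1 w2.
Proof.
move=> vw1 vw2; rewrite /W_const; apply: congr1; apply: eq_imagel => Q cQ.
rewrite (maximal_ae cQ vw1) (maximal_ae cQ vw2); apply: congr1.
by apply: congr1; apply: integral_ae_same (cube_measurable cQ) _;
  exact: ae_sameM (ae_same_powR a vw1) (ae_same_powR b vw2).
Qed.

Lemma W_infty_partial_ae (gamma ri rj p : R) w s w' s' :
  ae_same w w' -> ae_same s s' ->
  W_infty_partial gamma ri rj p w s = W_infty_partial gamma ri rj p w' s'.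
Proof.
move=> ww ss; rewrite /W_infty_partial.
apply: (congr1 (fun W => if (p <= gamma)%R then 1 else W)).
move: (_ / conj_exp (p / gamma))%R (_ / (rj / gamma))%R => a b.
exact: (W_const_ae a b ww ss).
Qed.

Lemma A_const_ae (p0 p1 p2 p : R) w s1 s2 w' s1' s2' :
  ae_same w w' -> ae_same s1 s1' -> ae_same s2 s2' ->
  A_const p0 p1 p2 p w s1 s2 = A_const p0 p1 p2 p w' s1' s2'.
Proof.
move=> ww ss1 ss2; rewrite /A_const; apply: congr1; apply: eq_imagel => Q cQ.
by rewrite (avg_ae cQ ww) (avg_ae cQ ss1) (avg_ae cQ ss2).
Qed.

Lemma wnorm_ae (r : R) s s' f : ae_same s s' -> measurable_fun setT f ->
  wnorm r s (EFin \o f) = wnorm r s' (EFin \o f).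
Proof.
move=> ss mf; rewrite /wnorm; congr (_ `^ _).
apply: (@integral_ae_same (fun x => `|f x| `^ r * s x)%R (fun x => `|f x| `^ r * s' x)%R).
  exact: measurableT.
by apply: ae_sameM => //; apply: ae_same_powR; apply: ae_same_norm; exact: ae_same_refl.
Qed.

Lemma sparse_op_ae (p0 gamma : R) (S : set (set (euclid R n))) f1 f2 g1 g2 :
  (forall Q, S Q -> is_cube Q) -> ae_same f1 g1 -> ae_same f2 g2 ->
  sparse_op p0 gamma S f1 f2 = sparse_op p0 gamma S g1 g2.
Proof.
move=> cS fg1 fg2; apply/funext => x; rewrite /sparse_op.
apply: (congr1 (fun y => y `^ gamma^-1)); apply: eq_esum => Q SQ.
by rewrite (pavg_ae _ (cS _ SQ) fg1) (pavg_ae _ (cS _ SQ) fg2).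
Qed.

Definition posw w x : R := if (0 < w x)%R then w x else 1%R.

Lemma posw_gt0 w x : (0 < posw w x)%R.
Proof. by rewrite /posw; case: ifP. Qed.

Lemma posw_ge w x : (w x <= posw w x)%R.
Proof. by rewrite /posw; case: ltP => // w0; exact: le_trans w0 ler01. Qed.

Lemma posw_ae w : weight w -> ae_same w (posw w).
Proof.
move=> [mw _ w0]; split=> //.
  apply: measurable_fun_ifT => //.
  exact: measurable_fun_ltr.
by apply: filterS w0 => x wx; rewrite /posw wx.
Qed.

Lemma positive_posw w : weight w -> positive_weight (posw w).
Proof.
move=> ww; have sw := posw_ae ww; have [_ mp _] := sw.
split; [exact: mp|by move=> x; exact: posw_gt0|move=> Q cQ].
rewrite -(integral_ae_same (cube_measurable cQ) sw).
by case: ww => _ iw _; move: (iw _ cQ); apply: integrable_lty; exact: cube_measurable.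
Qed.

Lemma wnorm_posw_le (r : R) w (g : euclid R n -> \bar R) : (0 < r)%R ->
  weight w -> wnorm r w g <= wnorm r (posw w) g.
Proof.
move=> r0 [_ _ w0]; have /andP[i0 ile] : 0 <= \int[volume]_x (`|g x| `^ r * (w x)%:E) <=
    \int[volume]_x (`|g x| `^ r * (posw w x)%:E).
  apply: ae_ge0_le_integral => [x|x|].
  - by rewrite lee_wpmul2l ?poweR_ge0 ?lee_fin ?posw_ge.
  - by rewrite mule_ge0 ?poweR_ge0 ?lee_fin ?ltW ?posw_gt0.
  - by apply: filterS w0 => x wx; rewrite mule_ge0 ?poweR_ge0 ?lee_fin ?ltW.
by apply: lee_poweR => //; rewrite invr_ge0 ltW.
Qed.

End ae_invariance.

Section sparse_norm.
Context {R : realType} {n : nat}.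
Implicit Types (f s w : euclid R n -> R) (S : set (set (euclid R n))).

Lemma positive_weight_avg w Q : positive_weight w -> is_cube Q -> 0 < avg w Q.
Proof.
move=> [mw w0 _] cQ; have v0 := cube_volume_gt0 cQ.
have vo := cube_volume_lty cQ.
rewrite /avg mule_gt0//.
  apply: integral_gt0 => //; first exact: cube_measurable.
  exact: measurable_funTS.
have v0' : volume Q != 0 by rewrite gt_eqF.
have vo' : volume Q != +oo by rewrite lt_eqF.
by rewrite (inve_gt0 v0' vo').
Qed.

Lemma unit_cube : is_cube (cube (nseq_tuple n 0%R : euclid R n) 1%R).
Proof. by exists 1%R => //; exists (nseq_tuple n 0%R). Qed.

Lemma A_const_gt0 (p0 p1 p2 p : R) w s1 s2 :
  positive_weight w -> positive_weight s1 -> positive_weight s2 ->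
  0 < A_const p0 p1 p2 p w s1 s2.
Proof.
move=> ww w1 w2; pose Q := cube (nseq_tuple n 0%R : euclid R n) 1%R.
have cQ : is_cube Q := unit_cube.
apply: (@lt_le_trans _ _ (avg w Q * avg s1 Q `^ (p / p0 / conj_exp (p1 / p0))
                         * avg s2 Q `^ (p / p0 / conj_exp (p2 / p0)))).
  apply: mule_gt0; last exact/poweR_gt0/positive_weight_avg.
  by apply: mule_gt0; [exact: positive_weight_avg|exact/poweR_gt0/positive_weight_avg].
by apply: ereal_sup_ubound; exists Q.
Qed.

Lemma W_const_ge0 (a b : R) v1 v2 : (forall x : euclid R n, (0 <= v1 x)%R) ->
  (forall x, (0 <= v2 x)%R) -> 0 <= W_const a b v1 v2.
Proof.
move=> v10 v20; apply: le_trans; last first.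
  apply: ereal_sup_ubound; exists (cube (nseq_tuple n 0%R : euclid R n) 1%R) => //.
  exact: unit_cube.
rewrite mule_ge0//.
  by apply: integral_ge0 => x _; rewrite mule_ge0 ?poweR_ge0.
rewrite inve_ge0; apply: integral_ge0 => x _.
by rewrite lee_fin mulr_ge0 ?powR_ge0.
Qed.

Lemma wnorm_sparse_op_le (p0 gamma p : R) S f1 f2 w B :
  (0 < gamma)%R -> (0 < p)%R -> countable S -> (forall Q, S Q -> measurable Q) ->
  measurable_fun setT w -> (forall x, (0 < w x)%R) -> 0 <= B ->
  (forall (I : finType) (Q : I -> set (euclid R n)), injective Q ->
    (forall i, S (Q i)) ->
    (\int[volume]_x ((\sum_i ((pavg p0 f1 (Q i) * pavg p0 f2 (Q i)) `^ gamma
       * (\1_(Q i) x)%:E)) `^ (p / gamma) * (w x)%:E)) `^ p^-1 <= B) ->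
  wnorm p w (sparse_op p0 gamma S f1 f2) <= B.
Proof.
move=> gamma0 p_gt0 cS mS mw w0 B0 HB.
have pN0 : p != 0%R by rewrite gt_eqF.
have i0 (g : euclid R n -> \bar R) r : 0 <= \int[volume]_x (g x `^ r * (w x)%:E).
  by apply: integral_ge0 => x _; rewrite mule_ge0 ?poweR_ge0// lee_fin ltW.
rewrite -[leRHS]poweRe1// -(mulfV pN0) poweRrM; apply: lee_poweR => //.
  by rewrite invr_ge0 ltW.
under eq_integral => x _.
  rewrite gee0_abs; last exact: poweR_ge0.
  rewrite /sparse_op -poweRrM mulrC; over.
apply: integral_esum_powR_le => //.
- by move=> Q; exact: poweR_ge0.
- exact: divr_gt0.
move=> I Q Qi SQ; rewrite -[leLHS]poweRe1// -(mulVf pN0) poweRrM.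
apply: lee_poweR (HB I Q Qi SQ); [exact: ltW|exact: poweR_ge0].
Qed.

Lemma gt0_lty_EFin (x : \bar R) : 0 < x -> x < +oo ->
  exists2 r : R, (0 < r)%R & x = r%:E.
Proof. by case: x => // r; rewrite lte_fin => r0 _; exists r. Qed.

Lemma poweR_finiteP (W : \bar R) (r : R) : 0 <= W -> (W = +oo -> r != 0%R) ->
  W `^ r = +oo \/ exists2 V : R, (0 <= V)%R & W = V%:E.
Proof.
case: W => [V V0 _|_ /(_ erefl) r0|//]; last by left; rewrite poweRyr.
by right; exists V.
Qed.

Lemma le_sum_poweR (L W W1 W2 : \bar R) (K r r1 r2 : R) : (0 < K)%R ->
  r != 0%R -> 0 <= W -> 0 <= W1 -> 0 <= W2 ->
  (W1 = +oo -> r1 != 0%R) -> (W2 = +oo -> r2 != 0%R) ->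
  (forall V V1 V2 : R, (0 <= V)%R -> (0 <= V1)%R -> (0 <= V2)%R ->
     W = V%:E -> W1 = V1%:E -> W2 = V2%:E ->
     (0 <= K * (V `^ r + (V1 `^ r1 + V2 `^ r2)))%R ->
     L <= (K * (V `^ r + (V1 `^ r1 + V2 `^ r2)))%:E) ->
  L <= K%:E * (W `^ r + (W1 `^ r1 + W2 `^ r2)).
Proof.
move=> K0 r0 W0 W10 W20 r10 r20 HL.
have infty (a b c : \bar R) : 0 <= a -> 0 <= b -> 0 <= c ->
    [\/ a = +oo, b = +oo | c = +oo] -> L <= K%:E * (a + (b + c)).
  move=> a0 b0 c0 abc; have -> : a + (b + c) = +oo.
    move: a b c a0 b0 c0 abc => [a| |] [b| |] [c| |]//= _ _ _.
    by case.
  by rewrite gt0_muley ?leey// lte_fin.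
have [Woo|[V V0 WV]] := poweR_finiteP W0 (fun=> r0).
  by apply: infty; rewrite ?poweR_ge0//; apply: Or31.
have [Woo|[V1 V10 WV1]] := poweR_finiteP W10 r10.
  by apply: infty; rewrite ?poweR_ge0//; apply: Or32.
have [Woo|[V2 V20 WV2]] := poweR_finiteP W20 r20.
  by apply: infty; rewrite ?poweR_ge0//; apply: Or33.
rewrite WV WV1 WV2 !poweR_EFin -!EFinD -EFinM; apply: HL => //.
by rewrite mulr_ge0 ?(ltW K0)// !addr_ge0 ?powR_ge0.
Qed.

Lemma W_infty_partial_ge0 (gamma a b p : R) v1 v2 :
  (forall x : euclid R n, (0 <= v1 x)%R) -> (forall x, (0 <= v2 x)%R) ->
  0 <= W_infty_partial gamma a b p v1 v2.
Proof.
move=> v10 v20; rewrite /W_infty_partial; case: (p <= gamma)%R; first exact: lee01.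
exact: W_const_ge0.
Qed.

Lemma W_infty_partial_exp_neq0 (gamma a b p : R) w s : (0 < gamma)%R ->
  (p < a)%R -> W_infty_partial gamma a b p w s = +oo ->
  (gamma * conj_exp (a / gamma))^-1%R != 0%R.
Proof.
move=> gamma_gt0 pa; rewrite /W_infty_partial; case: leP => [//|gp] _.
have ga : (1 < a / gamma)%R by rewrite ltr_pdivlMr// mul1r (lt_trans gp).
rewrite conj_expE// gt_eqF// invr_gt0 mulr_gt0// divr_gt0 ?subr_gt0//.
exact: lt_trans ga.
Qed.

Lemma sparse_op_norm_le (p0 gamma p1 p2 p K : R) S w s1 s2 :
  (0 < gamma)%R -> (0 < p)%R -> (0 <= K)%R -> countable S ->
  (forall Q, S Q -> is_cube Q) -> weight w -> weight s1 -> weight s2 ->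
  (forall f1 f2, in_Lp p1 (posw s1) f1 -> in_Lp p2 (posw s2) f2 ->
   forall (I : finType) (Q : I -> set (euclid R n)), injective Q ->
   (forall i, S (Q i)) ->
   (\int[volume]_x ((\sum_i
      ((pavg p0 (fun x => f1 x * posw s1 x `^ p0^-1)%R (Q i)
        * pavg p0 (fun x => f2 x * posw s2 x `^ p0^-1)%R (Q i)) `^ gamma
       * (\1_(Q i) x)%:E)) `^ (p / gamma) * (posw w x)%:E)) `^ p^-1 <=
   K%:E * wnorm p1 (posw s1) (EFin \o f1) * wnorm p2 (posw s2) (EFin \o f2)) ->
  sparse_op_norm p0 gamma S p1 p2 p s1 s2 w <= K%:E.
Proof.
move=> gamma_gt0 p_gt0 K0 cS SQ ww ws1 ws2 est.
have as1 := posw_ae ws1; have as2 := posw_ae ws2.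
have [mw w_gt0 _] := positive_posw ww.
apply: ereal_inf_lbound; exists K => //; split=> // f1 f2 [mf1 +] [mf2 +].
rewrite (wnorm_ae p1 as1 mf1) (wnorm_ae p2 as2 mf2) => f1lty f2lty.
have r1 := ae_sameM (ae_same_refl mf1) (ae_same_powR p0^-1 as1).
have r2 := ae_sameM (ae_same_refl mf2) (ae_same_powR p0^-1 as2).
rewrite (sparse_op_ae p0 gamma SQ r1 r2).
apply: le_trans (wnorm_posw_le _ p_gt0 ww) _.
apply: wnorm_sparse_op_le => //.
- by move=> Q /SQ; exact: cube_measurable.
- by rewrite !mule_ge0 ?poweR_ge0.
- by move=> I Q Qi SQi; exact: est.
Qed.

End sparse_norm.

Theorem theorem4p2 (R : realType) (n : nat) (gamma p0 p1 p2 p delta : R)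
    (n_gt0 : (0 < n)%N)
    (gamma_gt0 : (0 < gamma)%R) (p0_ge1 : (1 <= p0)%R)
    (p0_lt_p1 : (p0 < p1)%R) (p0_lt_p2 : (p0 < p2)%R)
    (pE : (p^-1 = p1^-1 + p2^-1)%R)
    (gamma_cond : (p0 <= gamma)%R \/ (gamma < p0)%R /\ (gamma < p)%R)
    (delta_gt0 : (0 < delta)%R) (delta_lt1 : (delta < 1)%R) :
  exists2 C : R, (0 < C)%R &
    forall (D S : set (set (euclid R n))),
      dyadic_grid D -> S `<=` D -> sparse delta S ->
    forall w s1 s2 : euclid R n -> R,
      weight w -> weight s1 -> weight s2 ->
      A_const p0 p1 p2 p w s1 s2 < +oo ->
      sparse_op_norm p0 gamma S p1 p2 p s1 s2 w <=
        C%:E * A_const p0 p1 p2 p w s1 s2 `^ p^-1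
        * (W_infty p1 p2 p s1 s2 `^ p^-1
           + (W_infty_partial gamma p1 p2 p w s2
                `^ (gamma * conj_exp (p1 / gamma))^-1
              + W_infty_partial gamma p2 p1 p w s1
                `^ (gamma * conj_exp (p2 / gamma))^-1)).
Proof.
have eq_le (x y : \bar R) : x = y -> x <= y by move=> ->.
have [C C0 est] := finite_estimate n_gt0 gamma_gt0 p0_ge1 p0_lt_p1 p0_lt_p2 pE
  delta_gt0 delta_lt1.
have p0_gt0 : (0 < p0)%R by exact: lt_le_trans p0_ge1.
have p1_gt0 : (0 < p1)%R by exact: lt_trans p0_lt_p1.
have p2_gt0 : (0 < p2)%R by exact: lt_trans p0_lt_p2.
have p_gt0 : (0 < p)%R by rewrite -invr_gt0 pE addr_gt0 ?invr_gt0.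
have pinvN0 : p^-1%R != 0%R by rewrite gt_eqF ?invr_gt0.
have pp1 : (p < p1)%R by rewrite -ltf_pV2// pE ltrDl invr_gt0.
have pp2 : (p < p2)%R by rewrite -ltf_pV2// pE ltrDr invr_gt0.
exists C => // D S gD SD spS w s1 s2 ww ws1 ws2.
have pw := positive_posw ww; have ps1 := positive_posw ws1.
have ps2 := positive_posw ws2.
have aw := posw_ae ww; have as1 := posw_ae ws1; have as2 := posw_ae ws2.
have We : W_infty p1 p2 p s1 s2 = W_infty p1 p2 p (posw s1) (posw s2).
  exact: W_const_ae as1 as2.
rewrite (A_const_ae p0 p1 p2 p aw as1 as2) We.
rewrite (W_infty_partial_ae gamma p1 p2 p aw as2).
rewrite (W_infty_partial_ae gamma p2 p1 p aw as1).
move=> Aoo; have [A A0 AE] := gt0_lty_EFin (A_const_gt0 p0 p1 p2 p pw ps1 ps2) Aoo.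
rewrite AE poweR_EFin -EFinM.
have CA0 : (0 < C * A `^ p^-1)%R by exact: mulr_gt0 C0 (powR_gt0 _ A0).
have w0 x : (0 <= posw w x)%R := ltW (posw_gt0 w x).
have s10 x : (0 <= posw s1 x)%R := ltW (posw_gt0 s1 x).
have s20 x : (0 <= posw s2 x)%R := ltW (posw_gt0 s2 x).
apply: (le_sum_poweR CA0 pinvN0 (W_const_ge0 (p / p1) (p / p2) s10 s20)
  (W_infty_partial_ge0 gamma p1 p2 p w0 s20)
  (W_infty_partial_ge0 gamma p2 p1 p w0 s10)
  (W_infty_partial_exp_neq0 gamma_gt0 pp1)
  (W_infty_partial_exp_neq0 gamma_gt0 pp2)).
move=> V V1 V2 V0 V10 V20 WV WV1 WV2 K0.
have cS : countable S.
  exact: sub_countable (subset_card_le SD) (dyadic_countable gD).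
apply: (sparse_op_norm_le gamma_gt0 p_gt0 K0 cS _ ww ws1 ws2).
  by move=> Q SQ; apply: (dyadic_is_cube gD); exact: SD.
move=> f1 f2 Lf1 Lf2 I Q Qi SQ.
exact: (est D S gD SD spS _ _ _ pw ps1 ps2 A V V1 V2 A0 V0 V10 V20
  (eq_le _ _ AE) (eq_le _ _ WV) (eq_le _ _ WV1) (eq_le _ _ WV2) f1 f2 Lf1 Lf2 I Q Qi SQ).
Qed.
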